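(* For any $R>0$ the function $$\exp\left(\left\|\sum_{n\in\mathbb{Z}}\frac{g_n(\omega)e^{inx}}{\langle n\rangle}\right\|_{L^4_x(\mathbb{T})}^4\right)\chi_R\left(\sum_{n\in\mathbb{Z}}\frac{|g_n(\omega)|^2}{\langle n\rangle^2}\right)$$ of $\omega$ lies in $L^q$ of the underlying probability space for every $1\le q<\infty$.
   Context: $\mathbb{T}=\mathbb{R}/2\pi\mathbb{Z}$; $\langle n\rangle=\sqrt{1+n^2}$. $(g_n)_{n\in\mathbb{Z}}$ is a sequence of i.i.d. centered normalized complex Gaussian random variables ($\mathbb{E}|g_n|^2=1$) on a probability space. $\chi\in C_0^\infty(\mathbb{R},\mathbb{R})$ satisfies $0\le\chi\le1$, $\chi(x)=1$ for $|x|<1$, $\chi$ supported in $[-2,2]$, and $\chi_R(\cdot)=\chi(\cdot/R)$. *)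

(* Defs.v *)
From mathcomp Require Export all_boot all_order all_algebra finmap.
From mathcomp Require Export complex.
From mathcomp Require Export all_classical all_reals all_analysis measurable_realfun.

Set Implicit Arguments.
Unset Strict Implicit.
Unset Printing Implicit Defensive.

Export Order.TTheory GRing.Theory Num.Theory.
Export numFieldNormedType.Exports.

Global Open Scope classical_set_scope.
Global Open Scope ring_scope.

Section Torus.
Context {R : realType}.

(* The torus R/2piZ is identified with its fundamental domain [0, 2pi[, with
   the (unnormalized) Lebesgue measure. *)
Definition torus : set R := `[0, 2 * pi[%classic.

Lemma measurable_torus : measurable torus.
Proof. exact: measurable_itv. Qed.

Definition torus_measure : {measure set (measurableTypeR R) -> \bar R} :=
  mrestr (@lebesgue_measure R) measurable_torus.

Definition expi (t : R) : R[i] := Complex (cos t) (sin t).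

Definition japanese (n : int) : R := Num.sqrt (1 + n%:~R ^+ 2).

Definition measurable_complex d (X : measurableType d) (D : set X)
    (f : X -> R[i]) : Prop :=
  measurable_fun D (@complex.Re R \o f) /\ measurable_fun D (@complex.Im R \o f).

Definition LnormT (p : R) (f : R -> R[i]) : \bar R :=
  Lnorm torus_measure p%:E (fun x => (Normc.normc (f x))%:E).

(* The sum over |n| <= N of c_n e^{inx}. *)
Definition fourier_partial (c : int -> R[i]) (N : nat) (x : R) : R[i] :=
  \sum_(k < N.*2.+1) c (k%:Z - N%:Z) * expi ((k%:Z - N%:Z)%:~R * x).

Definition is_fourier_sum (c : int -> R[i]) (f : R -> R[i]) : Prop :=
  measurable_complex torus f /\
  LnormT 2 (fun x => f x - fourier_partial c N x) @[N --> \oo] --> 0%E.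

(* The sum of the series in L^2(torus), i.e. a representative of its class; the
   junk value 0 is taken only when the series does not converge in L^2. *)
Definition fourier_sum (c : int -> R[i]) : R -> R[i] :=
  xget (fun=> 0) [set f | is_fourier_sum c f].

End Torus.

Section Cutoff.
Context {R : realType}.

Definition smooth (f : R -> R) : Prop :=
  forall (k : nat) (x : R), derivable (derive1n k f) x 1.

Definition is_cutoff (chi : R -> R) : Prop :=
  [/\ smooth chi,
      forall x, 0 <= chi x <= 1,
      forall x, `|x| < 1 -> chi x = 1 &
      closure [set x | chi x != 0] `<=` `[(-2), 2]%classic].

(* chi_r(s) = chi(s / r), extended to infinite arguments by 0, which is its limit
   there since chi has compact support. *)
Definition cutoff (chi : R -> R) (r : R) (s : \bar R) : \bar R :=
  if s is t%:E then (chi (t / r))%:E else 0%E.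

End Cutoff.

Section Gaussian.
Context {d : measure_display} {T : measurableType d} {R : realType}.
Variable P : probability T R.

Definition complex_pair (z : R[i]) : R * R := (complex.Re z, complex.Im z).

(* Centered complex Gaussian with E|Z|^2 = 1: Re Z and Im Z are independent real
   Gaussians of mean 0 and variance 1/2 (the second parameter of normal_prob is
   the standard deviation). *)
Definition std_complex_gaussian (Z : T -> R[i]) : Prop :=
  measurable_complex setT Z /\
  forall B : set (R * R), measurable B ->
    P ((complex_pair \o Z) @^-1` B) =
    (normal_prob 0 (Num.sqrt 2^-1) \x normal_prob 0 (Num.sqrt 2^-1))%E B.

Definition mutually_independent (I : choiceType) (Z : I -> T -> R[i]) : Prop :=
  forall (F : {fset I}) (B : I -> set (R * R)),
    (forall i, measurable (B i)) ->
    P (\bigcap_(i in [set` F]) ((complex_pair \o Z i) @^-1` B i)) =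
    (\prod_(i <- F) P ((complex_pair \o Z i) @^-1` B i))%E.

Definition iid_complex_gaussian (g : int -> T -> R[i]) : Prop :=
  (forall n, std_complex_gaussian (g n)) /\ mutually_independent g.

Definition in_Lp (p : R) (f : T -> \bar R) : Prop :=
  measurable_fun setT f /\ (Lnorm P p%:E f < +oo)%E.

Definition random_coef (g : int -> T -> R[i]) (w : T) (n : int) : R[i] :=
  g n w / (japanese n)%:C%C.

Definition random_mass (g : int -> T -> R[i]) (w : T) : \bar R :=
  (\esum_(n in [set: int]) (Normc.normc (g n w) ^+ 2 / japanese n ^+ 2)%:E)%E.

End Gaussian.

(* Main.v *)
(** Write [X] for the fourth power of the [L^4] norm of the random Fourier
    series and [m = 2 r], so that the cutoff restricts to mass at most [m].
    It suffices to bound [E (exp (q X); mass <= m)].  Split the series at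
    frequency [N].  On [mass <= m] the low part obeys
    [sup |low|^2 <= (2 N + 1) m] and [|low|_2^2 <= 2 pi m], so its contribution
    to [X] is [O(N)].  The high part is, at each point, Gaussian with variance
    [O(1 / N)], so by Jensen the [k]-th moment of [|high|_4^4] is at most
    [C^k (4 k)! N^(-4 k) exp (N / 2)].  Taking [N] equal to a small multiple of
    [k], the [k]-th term of the exponential series is summable.  This is
    uniform in the truncation of the series, and Fatou's lemma concludes.

    For the limit and for the measurability of [X], replace [|z|^4] by
    [min(|z|, K)^4]: its integral is continuous for [L^2] convergence, hence
    the integral for the full series is a limit of integrals of trigonometric
    polynomials, which are measurable in [omega] by Tonelli, and [K] is then
    sent to infinity by monotone convergence. *)
From HB Require Import structures.
Require Import Defs.
From mathcomp Require Import ring lra zify.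

Set Implicit Arguments.
Unset Strict Implicit.
Unset Printing Implicit Defensive.

(** * Trigonometric polynomials on the torus *)

(** The cutoff cannot be dropped: already for one mode the exponential of the fourth power of a
    Gaussian has infinite expectation. Nor can [N] be fixed: the bound on the high part, divided by
    k!, would grow like k^(3 k). So the frequency split is made inside the exponential series, with
    a different [N] for each term. A small multiple of k suits both halves. The low part contributes
    (C N)^k / k!, which k^k <= e^k k! makes geometric with ratio at most 1/2 once N / k is small.
    For the high part, (4 k)! N^(-4 k) is at most geometric in k however small the fixed ratio N / k
    is, and the remaining 1 / k! makes the series converge. *)

Section Normc.
Context {R : realType}.
Implicit Types z w : R[i].
Local Notation normc := (@Normc.normc R).

Lemma normc_sqr z : normc z ^+ 2 = complex.Re z ^+ 2 + complex.Im z ^+ 2.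
Proof. by case: z => a b /=; rewrite sqr_sqrtr// addr_ge0 ?sqr_ge0. Qed.

Lemma normc_ge0 z : 0 <= normc z.
Proof. by case: z => a b /=; rewrite sqrtr_ge0. Qed.

(* The library states the next two facts for [Rcomplex R], whose additive
   structure is only convertible to the one of [R[i]]. *)
Lemma normcD_le z w : normc (z + w) <= normc z + normc w.
Proof. exact: le_normcD. Qed.

Lemma normc_opp z : normc (- z) = normc z.
Proof. exact: normcN. Qed.

Lemma ler_dist_normc z w : `|normc z - normc w| <= normc (z - w).
Proof.
rewrite ler_norml; apply/andP; split.
  rewrite lerNl opprB lerBlDl; have := normcD_le (w - z) z.
  rewrite subrK -opprB normc_opp => /le_trans; apply; by rewrite addrC.
by rewrite lerBlDr; have := normcD_le (z - w) w; rewrite subrK.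
Qed.

Lemma normc_sqrD_le z w :
  normc (z + w) ^+ 2 <= 2 * (normc z ^+ 2 + normc w ^+ 2).
Proof.
have := normcD_le z w; have := normc_ge0 (z + w).
move: (normc z) (normc w) (normc (z + w)) => a b c c0 cab.
have : c ^+ 2 <= (a + b) ^+ 2 by rewrite lerXn2r// nnegrE (le_trans c0).
by have := sqr_ge0 (a - b); nra.
Qed.

Lemma ReD z w : complex.Re (z + w) = complex.Re z + complex.Re w.
Proof. by case: z w => ? ? []. Qed.
Lemma ImD z w : complex.Im (z + w) = complex.Im z + complex.Im w.
Proof. by case: z w => ? ? []. Qed.
Lemma ReN z : complex.Re (- z) = - complex.Re z. Proof. by case: z. Qed.
Lemma ImN z : complex.Im (- z) = - complex.Im z. Proof. by case: z. Qed.

Lemma Re_sum I (s : seq I) (P : pred I) (F : I -> R[i]) :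
  complex.Re (\sum_(i <- s | P i) F i) = \sum_(i <- s | P i) complex.Re (F i).
Proof. exact: (big_morph _ ReD). Qed.

Lemma Im_sum I (s : seq I) (P : pred I) (F : I -> R[i]) :
  complex.Im (\sum_(i <- s | P i) F i) = \sum_(i <- s | P i) complex.Im (F i).
Proof. exact: (big_morph _ ImD). Qed.

Lemma Re_mul_expi z (t : R) :
  complex.Re (z * expi t) = complex.Re z * cos t - complex.Im z * sin t.
Proof. by case: z. Qed.

Lemma Im_mul_expi z (t : R) :
  complex.Im (z * expi t) = complex.Re z * sin t + complex.Im z * cos t.
Proof. by case: z => a b. Qed.

End Normc.

Section MeasurableComplex.
Context d (X : measurableType d) (R : realType).
Implicit Types (D : set X) (f g : X -> R[i]).

Lemma measurable_normc D f :
  measurable_complex D f -> measurable_fun D (fun x => Normc.normc (f x)).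
Proof.
move=> [mr mi].
have -> : (fun x => Normc.normc (f x)) =
    (Num.sqrt : R -> R) \o (fun x => complex.Re (f x) ^+ 2 + complex.Im (f x) ^+ 2).
  by apply/funext => x /=; case: (f x).
apply: measurableT_comp; first by apply: continuous_measurable_fun;
  exact: sqrt_continuous.
by apply: measurable_funD; apply: measurable_funX.
Qed.

Lemma measurable_complexD D f g : measurable_complex D f ->
  measurable_complex D g -> measurable_complex D (fun x => f x + g x).
Proof.
move=> [fr fi] [gr gi]; split.
  rewrite (_ : _ \o _ = (@complex.Re R \o f) \+ (@complex.Re R \o g)).
    exact: measurable_funD.
  by apply/funext => x /=; rewrite ReD.
rewrite (_ : _ \o _ = (@complex.Im R \o f) \+ (@complex.Im R \o g)).
  exact: measurable_funD.
by apply/funext => x /=; rewrite ImD.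
Qed.

Lemma measurable_complexN D f : measurable_complex D f ->
  measurable_complex D (fun x => - f x).
Proof.
move=> [fr fi]; split.
  rewrite (_ : _ \o _ = \- (@complex.Re R \o f)); first exact: measurable_funN.
  by apply/funext => x /=; rewrite ReN.
rewrite (_ : _ \o _ = \- (@complex.Im R \o f)); first exact: measurable_funN.
by apply/funext => x /=; rewrite ImN.
Qed.

Lemma measurable_complex_sum I (s : seq I) D (F : I -> X -> R[i]) :
  (forall i, measurable_complex D (F i)) ->
  measurable_complex D (fun x => \sum_(i <- s ) F i x).
Proof.
move=> mF; split.
  rewrite (_ : _ \o _ = fun x => \sum_(i <- s ) complex.Re (F i x)).
    by apply: measurable_sum => i; case: (mF i).
  by apply/funext => x /=; rewrite Re_sum.
rewrite (_ : _ \o _ = fun x => \sum_(i <- s ) complex.Im (F i x)).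
  by apply: measurable_sum => i; case: (mF i).
by apply/funext => x /=; rewrite Im_sum.
Qed.

End MeasurableComplex.

Section Trig.
Context {R : realType}.
Implicit Types (c : int -> R[i]) (s : seq int).

Definition trig c s (x : R) : R[i] := \sum_(n <- s) c n * expi (n%:~R * x).

Definition energy c s : R := \sum_(n <- s) Normc.normc (c n) ^+ 2.

Lemma energy_ge0 c s : 0 <= energy c s.
Proof. by apply: sumr_ge0 => n _; exact: sqr_ge0. Qed.

Lemma trig_cat c s1 s2 x : trig c (s1 ++ s2) x = trig c s1 x + trig c s2 x.
Proof. by rewrite /trig big_cat. Qed.

Lemma energy_cat c s1 s2 : energy c (s1 ++ s2) = energy c s1 + energy c s2.
Proof. by rewrite /energy big_cat. Qed.

Lemma perm_trig c s1 s2 x : perm_eq s1 s2 -> trig c s1 x = trig c s2 x.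
Proof. exact: perm_big. Qed.

Lemma perm_energy c s1 s2 : perm_eq s1 s2 -> energy c s1 = energy c s2.
Proof. exact: perm_big. Qed.

End Trig.

(** * Integration over the torus and Parseval's identity *)

Section Torus.
Context {R : realType}.
Local Notation muT := (@torus_measure R).
Local Notation leb := (@lebesgue_measure R).

Lemma torus_measureT : muT [set: _] = (2 * pi)%:E.
Proof.
rewrite /torus_measure /= /mrestr setTI lebesgue_measure_itv /= lte_fin.
by rewrite mulr_gt0 ?pi_gt0// sube0.
Qed.

Lemma torus_measure_lty : (muT [set: _] < +oo)%E.
Proof. by rewrite torus_measureT ltry. Qed.

Lemma integral_torus (f : R -> \bar R) : measurable_fun setT f ->
  (\int[muT]_x f x = \int[leb]_(x in torus) f x)%E.
Proof.
move=> mf.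
have mD : measurable (~` torus : set (measurableTypeR R)) by apply: measurableC;
  exact: measurable_itv.
have D0 : muT (~` torus) = 0%E by rewrite /torus_measure/= /mrestr setICl measure0.
rewrite -(setUv torus) integral_setU //=; [|exact: measurable_itv|by rewrite
  setUv|by apply/disj_setPS; rewrite setICr].
rewrite [X in (_ + X)%E]null_set_integral ?adde0//; last exact: measurable_funTS.
apply: eq_measure_integral => A mA AD.
by rewrite /torus_measure/= /mrestr (setIidl AD).
Qed.

Lemma eq_integral_torus_measure (m : {measure set (measurableTypeR R) -> \bar R})
    (f : R -> \bar R) : (forall A, measurable A -> m A = muT A) ->
  (\int[muT]_x f x = \int[m]_x f x)%E.
Proof. by move=> h; apply: eq_measure_integral => A mA _; rewrite h. Qed.

Let torus_lty : (leb torus < +oo)%E.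
Proof.
by rewrite -[torus]setTI -[leb _]/(muT setT) torus_measureT ltry.
Qed.

(** The same set function as [torus_measure], now carrying its finiteness, which Tonelli's theorem
    asks for. *)
Definition torus_fmeasure : {finite_measure set (measurableTypeR R) -> \bar R} :=
  @mfrestr _ (measurableTypeR R) R torus leb (@measurable_torus R) torus_lty.

Lemma measurable_torus_integral d (T : measurableType d) (f : T * R -> \bar R) :
  measurable_fun setT f -> (forall z, 0 <= f z)%E ->
  measurable_fun setT (fun w => \int[muT]_x f (w, x))%E.
Proof.
move=> mf f0.
have -> : (fun w => \int[muT]_x f (w, x))%E = fubini_F torus_fmeasure f.
  by apply/funext => w; apply: eq_integral_torus_measure.
exact: (@measurable_fun_fubini_tonelli_F _ _ T (measurableTypeR R)).
Qed.

Lemma torus_tonelli d (T : measurableType d) (m : {sigma_finite_measure set T ->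
    \bar R})
    (f : T * R -> \bar R) :
  measurable_fun setT f -> (forall z, 0 <= f z)%E ->
  (\int[m]_w \int[muT]_x f (w, x) = \int[muT]_x \int[m]_w f (w, x))%E.
Proof.
move=> mf f0; rewrite (eq_integral_torus_measure (m := torus_fmeasure))//.
rewrite -(@fubini_tonelli _ _ T (measurableTypeR R) R m torus_fmeasure)//.
Qed.

Let wave (a b : R) (k : int) (x : R) : R := a * cos (k%:~R * x) + b * sin (k%:~R * x).

Let is_derive_wave (k a b x : R) : is_derive x 1
  (fun x => a * sin (k * x) - b * cos (k * x)) (k * (a * cos (k * x) + b * sin (k *
    x))).
Proof.
apply: is_derive_eq.
rewrite /GRing.scale /=. ring.
Qed.

Let continuous_wave a b k : continuous (wave a b k).
Proof.
move=> x; apply: differentiable_continuous; apply/derivable1_diffP.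
have -> : wave a b k = fun x => b * sin (k%:~R * x) - (- a) * cos (k%:~R * x).
  by apply/funext => y; rewrite mulNr opprK addrC.
by case: (is_derive_wave k%:~R b (- a) x).
Qed.

Let integrable_wave a b k : muT.-integrable setT (EFin \o wave a b k).
Proof.
apply: (@measurable_bounded_integrable _ (measurableTypeR R)) => //.
- exact: torus_measure_lty.
- apply: continuous_measurable_fun; exact: continuous_wave.
- exists (`|a| + `|b|); split; first exact: num_real.
  move=> M abM x _ /=; rewrite (le_trans _ (ltW abM))// (le_trans (ler_normD _ _))//.
  by rewrite lerD// normrM ler_piMr// ler_norml ?cos_geN1 ?cos_le1 ?sin_geN1 ?sin_le1.
Qed.

Let sin_pi_int (k : int) : sin (k%:~R * (2 * pi)) = 0 :> R.
Proof.
have h n : sin (n%:R * (2 * pi)) = 0 :> R.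
  by rewrite -[_ * _]add0r mulr_natl [2 * _]mulr_natl (periodicn (@sinD2pi R)) sin0.
by case: k => n; rewrite ?NegzE ?mulrNz ?mulNr ?sinN h ?oppr0.
Qed.

Let cos_pi_int (k : int) : cos (k%:~R * (2 * pi)) = 1 :> R.
Proof.
have h n : cos (n%:R * (2 * pi)) = 1 :> R.
  by rewrite -[_ * _]add0r mulr_natl [2 * _]mulr_natl (periodicn (@cosD2pi R)) cos0.
by case: k => n; rewrite ?NegzE ?mulrNz ?mulNr ?cosN h.
Qed.

Let integral_wave a b k :
  (\int[muT]_x (wave a b k x)%:E = (if k == 0 then 2 * pi * a else 0)%:E)%E.
Proof.
have [->|k0] := eqVneq k 0.
  rewrite (_ : (fun x => (wave a b 0 x)%:E) = cst a%:E); last first.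
    by apply/funext => x; rewrite /wave mul0r cos0 sin0 mulr1 mulr0 addr0.
  by rewrite integral_cst// (torus_measureT : muT setT = _) -EFinM mulrC.
have k0' : k%:~R != 0 :> R by rewrite intr_eq0.
rewrite integral_torus; last first.
  by apply/measurable_EFinP; apply: continuous_measurable_fun; exact: continuous_wave.
rewrite integral_itv_bndo_bndc; last first.
  by apply/measurable_EFinP/measurable_funTS; apply: continuous_measurable_fun;
    exact: continuous_wave.
pose F x : R := k%:~R^-1 * (a * sin (k%:~R * x) - b * cos (k%:~R * x)).
have dF (x : R) : is_derive x 1 F (wave a b k x).
  have := is_derive_wave k%:~R a b x => h.
  apply: is_derive_eq; rewrite /GRing.scale/= /wave; field. exact: k0'.
rewrite (@continuous_FTC2 _ _ F).
- rewrite /F mulr0 sin0 cos0 sin_pi_int cos_pi_int -EFinB; congr EFin. ring.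
- by rewrite mulr_gt0 ?pi_gt0.
- by apply: continuous_subspaceT => x; exact: continuous_wave.
- have cF : continuous F.
    by move=> x; apply: differentiable_continuous; apply/derivable1_diffP; case: (dF x).
  split.
  + by move=> x _; case: (dF x).
  + by apply: cvg_at_right_filter; exact: cF.
  + by apply: cvg_at_left_filter; exact: cF.
- by move=> x _; rewrite derive1E derive_val.
Qed.

Lemma trig_parseval (c : int -> R[i]) (s : seq int) : uniq s ->
  (\int[muT]_x (Normc.normc (trig c s x) ^+ 2)%:E = (2 * pi * energy c s)%:E)%E.
Proof.
move=> us.
(* [A n m] and [- B n m] are the real and imaginary parts of [c n] times the conjugate of [c m], so
   the squared modulus becomes a double sum of real waves of frequency [n - m], and only the
   diagonal has nonzero mean. *)
pose A n m := complex.Re (c n) * complex.Re (c m) + complex.Im (c n) * complex.Im (c m).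
pose B n m := complex.Re (c n) * complex.Im (c m) - complex.Im (c n) * complex.Re (c m).
have E x : (Normc.normc (trig c s x) ^+ 2)%:E =
    (\sum_(n <- s) \sum_(m <- s) (wave (A n m) (B n m) (n - m) x)%:E)%E.
  under eq_bigr do rewrite sumEFin.
  rewrite sumEFin normc_sqr /trig Re_sum Im_sum !expr2 !big_distrlr -big_split /=.
  congr EFin; apply: eq_bigr => n _; rewrite -big_split; apply: eq_bigr => m _.
  rewrite /= !Re_mul_expi !Im_mul_expi /wave intrB [(_ - _) * x]mulrBl cosB sinB /A /B.
  ring.
under eq_integral do rewrite E.
rewrite integral_sum//; last first.
  by move=> n; apply: integrable_sum => // m _; exact: integrable_wave.
transitivity (\sum_(n <- s) (2 * pi * Normc.normc (c n) ^+ 2)%:E)%E; last first.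
  by rewrite sumEFin /energy mulr_sumr.
apply: eq_big_seq => n ns.
rewrite integral_sum//; last by move=> m; exact: integrable_wave.
under eq_bigr do rewrite integral_wave subr_eq0.
rewrite (bigD1_seq n)//= eqxx big1 ?adde0; last first.
  by move=> m mn; rewrite eq_sym (negbTE mn).
by rewrite normc_sqr /A !expr2.
Qed.

End Torus.

(** * Splitting a partial sum at a frequency *)

Section Modes.
Context {R : realType}.
Implicit Types (c : int -> R[i]).

Definition modes (N : nat) : seq int :=
  [seq k%:Z - N%:Z | k <- iota 0 N.*2.+1].

Lemma fourier_partialE c N x : fourier_partial c N x = trig c (modes N) x.
Proof.
rewrite /fourier_partial /trig /modes big_map.
by rewrite -(big_mkord xpredT (fun k : nat => c (k%:Z - N%:Z) * expi ((k%:Z -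
  N%:Z)%:~R * x))) /index_iota subn0.
Qed.

Lemma uniq_modes N : uniq (modes N).
Proof. by rewrite map_inj_uniq ?iota_uniq// => i j /addIr[]. Qed.

Lemma size_modes N : size (modes N) = N.*2.+1.
Proof. by rewrite size_map size_iota. Qed.

Lemma mem_modes N (n : int) : (n \in modes N) = (`|n| <= N)%N.
Proof.
apply/mapP/idP => [[k]|nN].
  rewrite mem_iota add0n => /andP[_]; rewrite ltnS -muln2 => kN ->; lia.
exists (absz (n + N%:Z)); last by lia.
rewrite mem_iota add0n; lia.
Qed.

Definition high (N M : nat) : seq int := [seq n <- modes M | (N < `|n|)%N].
Definition low (N M : nat) : seq int := [seq n <- modes M | (`|n| <= N)%N].

Lemma perm_low_high N M : perm_eq (modes M) (low N M ++ high N M).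
Proof.
rewrite perm_sym /low /high; under [X in _ ++ X]eq_filter do rewrite ltnNge.
by rewrite (perm_filterC (fun n : int => `|n| <= N)%N).
Qed.

Lemma perm_low N M : (N <= M)%N -> perm_eq (low N M) (modes N).
Proof.
move=> NM; apply: uniq_perm; rewrite ?filter_uniq ?uniq_modes// => n.
by rewrite mem_filter !mem_modes; apply: andb_idr => /leq_trans; apply.
Qed.

Lemma size_low N M : (size (low N M) <= N.*2.+1)%N.
Proof.
rewrite -size_modes; apply: uniq_leq_size; first by rewrite filter_uniq ?uniq_modes.
by move=> n; rewrite mem_filter !mem_modes => /andP[].
Qed.

Lemma trig_modes_split c N M x :
  trig c (modes M) x = trig c (low N M) x + trig c (high N M) x.
Proof. by rewrite (perm_trig _ _ (perm_low_high N M)) trig_cat. Qed.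

Lemma energy_modes_split c N M :
  energy c (modes M) = energy c (low N M) + energy c (high N M).
Proof. by rewrite (perm_energy _ (perm_low_high N M)) energy_cat. Qed.

Lemma trig_modesB c N M x : (N <= M)%N ->
  trig c (modes M) x - trig c (modes N) x = trig c (high N M) x.
Proof.
by move=> NM; rewrite (trig_modes_split c N) (perm_trig _ _ (perm_low NM)) addrC addKr.
Qed.

Lemma energy_modesB c N M : (N <= M)%N ->
  energy c (modes M) - energy c (modes N) = energy c (high N M).
Proof.
by move=> NM; rewrite (energy_modes_split c N) (perm_energy _ (perm_low NM)) addrC
  addKr.
Qed.

Lemma uniq_low N M : uniq (low N M).
Proof. by rewrite /low /high filter_uniq ?uniq_modes. Qed.

Lemma uniq_high N M : uniq (high N M).
Proof. by rewrite /low /high filter_uniq ?uniq_modes. Qed.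

Lemma energy_modes_nd c : nondecreasing_seq (fun N => energy c (modes N)).
Proof. by move=> N M NM; rewrite -subr_ge0 energy_modesB// energy_ge0. Qed.

(** Cauchy-Schwarz against the constant sequence 1, obtained by summing 2 a b <= a^2 + b^2 over all
    pairs of modes. It is the sup bound for the low frequencies. *)
Lemma normc_trig_sqr_le c s (x : R) :
  Normc.normc (trig c s x) ^+ 2 <= (size s)%:R * energy c s.
Proof.
have h : Normc.normc (trig c s x) <= \sum_(n <- s) Normc.normc (c n).
  rewrite /trig; elim: s => [|n s ih]; first by rewrite !big_nil Normc.normc0.
  rewrite !big_cons (le_trans (normcD_le _ _))// lerD// Normc.normcM.
  by rewrite [X in _ * X](_ : _ = 1) ?mulr1// /= cos2Dsin2 sqrtr1.
apply: (@le_trans _ _ ((\sum_(n <- s) Normc.normc (c n)) ^+ 2)).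
  by rewrite lerXn2r// nnegrE ?normc_ge0// sumr_ge0// => n _; exact: normc_ge0.
rewrite expr2 big_distrlr /=.
apply: (@le_trans _ _ (\sum_(n <- s) \sum_(m <- s)
   (Normc.normc (c n) ^+ 2 / 2 + Normc.normc (c m) ^+ 2 / 2))).
  apply: ler_sum => n _; apply: ler_sum => m _.
  have := sqr_ge0 (Normc.normc (c n) - Normc.normc (c m)); nra.
under eq_bigr do rewrite big_split /=.
rewrite big_split /= [X in _ + X]exchange_big /= -big_split /= /energy mulr_sumr.
apply: ler_sum => n _.
by rewrite !big_const_seq !count_predT !iter_addr_0 -mulrnDl -splitr mulr_natl.
Qed.

End Modes.

(** * Convergence in mean square *)

Section Sequences.
Context {R : realType}.

Lemma cvge0_ge0P (u : (\bar R)^nat) : (forall n, 0 <= u n)%E ->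
  (u @ \oo --> 0%E) <-> (forall e : R, 0 < e -> \forall n \near \oo, (u n <= e%:E)%E).
Proof.
move=> u0; split=> [/fine_cvgP[uf uc] e e0|h].
  near=> n.
  have un : (u n \is a fin_num) by near: n.
  rewrite -(fineK un) lee_fin; apply: ltW; apply: le_lt_trans (ler_norm _) _.
  rewrite -[fine _]subr0 -normrN opprB; near: n.
  by move/cvgrPdist_lt: uc => /(_ e e0).
apply/fine_cvgP; split.
  have := h 1 ltr01; apply: filterS => n un.
  by rewrite ge0_fin_numE// (le_lt_trans un) ?ltry.
apply/cvgrPdist_le => e e0; have := h e e0; apply: filterS => n un.
have uf : (u n \is a fin_num) by rewrite ge0_fin_numE// (le_lt_trans un) ?ltry.
by rewrite sub0r normrN ger0_norm ?fine_ge0// -lee_fin fineK.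
Unshelve. all: by end_near. Qed.

Lemma geometric_increments_cvg (v : R^nat) (C : R) :
  (forall k, `|v k.+1 - v k| <= C * (2^-1) ^+ k) -> cvgn v.
Proof.
move=> h.
have h2 : cvgn (series (telescope v)).
  apply: normed_cvg; apply: (@series_le_cvg _ _ (geometric C 2^-1)) => //=.
  - by move=> n; rewrite (le_trans _ (h n)).
  - by apply: is_cvg_geometric_series; rewrite ger0_norm// invf_lt1// ltr1n.
have -> : v = cst (v 0%N) \+ series (telescope v).
  by apply/funext => n; rewrite /= -eq_sum_telescope.
apply: is_cvgD => //; exact: is_cvg_cst.
Qed.

Lemma limn_einf_le_cst (u : (\bar R)^nat) (b : \bar R) :
  (forall n, u n <= b)%E -> (limn_einf u <= b)%E.
Proof.
move=> ub; rewrite limn_einf_lim; apply: lime_le.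
  exact: is_cvg_einfs.
apply: nearW => n; apply: le_trans (ub n).
by apply: ereal_inf_lbound; exists n => /=.
Qed.

Lemma limn_einf_ge0 (u : (\bar R)^nat) :
  (forall n, 0 <= u n)%E -> (0 <= limn_einf u)%E.
Proof.
move=> u0; rewrite limn_einf_lim; apply: lime_ge; first exact: is_cvg_einfs.
by apply: nearW => n; apply: le_ereal_inf_tmp => _ [k _ <-].
Qed.

Lemma measurable_limn_einf d (T : measurableType d) (D : set T) (f : (T -> \bar
    R)^nat) :
  (forall n, measurable_fun D (f n)) -> measurable_fun D (fun x => limn_einf (f ^~ x)).
Proof.
move=> mf; apply: measurableT_comp => //.
by apply: measurable_fun_limn_esup => n; apply: measurableT_comp.
Qed.

Lemma ge0_poweR_nat (x : \bar R) (n : nat) : (0 < n)%N -> (0 <= x)%E ->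
  (x `^ n%:R = x ^+ n)%E.
Proof.
move=> n0; case: x => [r r0||//].
- by rewrite poweR_EFin powR_mulrn// EFin_expe.
- rewrite poweRyr ?pnatr_eq0 -?lt0n//.
  case: n n0 => // n _; elim: n => [|n ih]; first by rewrite expeS expe0 mule1.
  by move=> _; rewrite expeS -ih// mulyy.
Qed.

End Sequences.

Section L2.
Context {R : realType}.
Local Notation muT := (@torus_measure R).
Local Notation normc := (@Normc.normc R).

(* No measurability of [f] off the torus: [is_fourier_sum] gives none. *)
Lemma ge0_integral_torus_measure (f : R -> \bar R) :
  (forall x, 0 <= f x)%E -> measurable_fun (torus : set R) f ->
  (\int[muT]_x f x = \int[muT]_(x in torus) f x)%E.
Proof.
move=> f0 mf; have mtor : measurable (torus : set (measurableTypeR R)) by exact: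
  measurable_itv.
apply/eqP; rewrite eq_le; apply/andP; split; last first.
  rewrite integral_mkcond !ge0_integralTE//; last first.
    move=> x; rewrite patchE; case: ifP => _ //; exact: f0.
  apply: ereal_sup_le => _ [h hf <-]; exists h => // x.
  apply: le_trans (hf x) _; rewrite patchE; case: ifP => // _; exact: f0.
Import HBNNSimple.
(* The integral is a supremum over simple functions below [f]. These are measurable everywhere, so
   the null complement of the torus is discarded from them instead of from [f]. *)
rewrite ge0_integralTE//; apply: ge_ereal_sup => _ [h hf <-].
rewrite -[sintegral _ _]integralT_nnsfun.
have D0 : muT (~` torus) = 0%E by rewrite /torus_measure/= /mrestr setICl measure0.
rewrite (@ge0_negligible_integral _ _ _ muT setT (~` torus))//; last first.
- by move=> x _; rewrite lee_fin; exact: fun_ge0.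
- exact/measurable_EFinP.
- exact: measurableC.
rewrite setTD setCK; apply: ge0_le_integral => //.
- by move=> x _; rewrite lee_fin; exact: fun_ge0.
- exact/measurable_EFinP/measurable_funTS.
Qed.

Lemma LnormT_ge0 p (f : R -> R[i]) : (0 <= LnormT p f)%E.
Proof. exact: Lnorm_ge0. Qed.

Lemma LnormTX (p : nat) (f : R -> R[i]) : (0 < p)%N ->
  (LnormT p%:R f ^+ p = \int[muT]_x (normc (f x) ^+ p)%:E)%E.
Proof.
move=> p0; rewrite -ge0_poweR_nat ?LnormT_ge0// /LnormT poweR_Lnorm ?pnatr_eq0 -?lt0n//.
by apply: eq_integral => x _ /=; rewrite ger0_norm ?normc_ge0// powR_mulrn ?normc_ge0.
Qed.

Lemma LnormT2_cvg0P (F : nat -> R -> R[i]) :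
  (LnormT 2 (F n) @[n --> \oo] --> 0%E) <->
  ((\int[muT]_x (normc (F n x) ^+ 2)%:E @[n --> \oo] --> 0)%E).
Proof.
have I0 n : (0 <= \int[muT]_x (normc (F n x) ^+ 2)%:E)%E.
  by apply: integral_ge0 => x _; rewrite lee_fin sqr_ge0.
rewrite !cvge0_ge0P//; last by move=> n; exact: LnormT_ge0.
split=> h e e0.
  have := h (Num.sqrt e); rewrite sqrtr_gt0 => /(_ e0); apply: filterS => n.
  rewrite -(@LnormTX 2)// => le; rewrite -[e]sqr_sqrtr ?(ltW e0)//.
  by rewrite EFin_expe lee_sqr ?LnormT_ge0// lee_fin sqrtr_ge0.
have := h (e ^+ 2); rewrite exprn_gt0// => /(_ isT); apply: filterS => n.
by rewrite -(@LnormTX 2)// EFin_expe lee_sqr ?LnormT_ge0// lee_fin ltW.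
Qed.

Lemma term_le_eseries (u : nat -> R) (k : nat) : (forall n, 0 <= u n) ->
  ((u k)%:E <= \sum_(0 <= n <oo) (u n)%:E)%E.
Proof.
move=> u0; apply: le_trans (nneseries_lim_ge k.+1 _); last by move=> n _ _;
  rewrite lee_fin.
by rewrite big_nat_recr//= leeDr// sume_ge0// => n _; rewrite lee_fin.
Qed.

Lemma measurable_trig c s : measurable_complex setT (@trig R c s).
Proof.
apply: measurable_complex_sum => n; split.
  rewrite (_ : _ \o _ = fun x => complex.Re (c n) * cos (n%:~R * x) - complex.Im (c
    n) * sin (n%:~R * x)).
    apply: continuous_measurable_fun => x.
    by apply: differentiable_continuous; apply/derivable1_diffP; apply: ex_derive.
  by apply/funext => x /=; rewrite Re_mul_expi.
rewrite (_ : _ \o _ = fun x => complex.Re (c n) * sin (n%:~R * x) + complex.Im (c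
  n) * cos (n%:~R * x)).
  apply: continuous_measurable_fun => x.
  by apply: differentiable_continuous; apply/derivable1_diffP; apply: ex_derive.
by apply/funext => x /=; rewrite Im_mul_expi.
Qed.

Lemma measurable_normcX d (X : measurableType d) (D : set X) (f : X -> R[i]) n :
  measurable_complex D f -> measurable_fun D (fun x => (normc (f x) ^+ n)%:E).
Proof. by move=> mf; apply/measurable_EFinP/measurable_funX/measurable_normc. Qed.

(* The rate [16^-k] leaves room for the weights [4^k] in [riesz_fischer], which
   turn summability in mean square into pointwise geometric increments. *)
Lemma fast_subsequence (E : R^nat) : nondecreasing_seq E -> has_ubound (range E) ->
  exists m : nat -> nat, (forall k, (k <= m k)%N) /\ (forall k, (m k <= m k.+1)%N) /\
    forall k, sup (range E) - E (m k) <= (16^-1) ^+ k.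
Proof.
move=> ndE ubE.
have cE := nondecreasing_cvgn ndE ubE.
have supE n : E n <= sup (range E) by apply: ub_le_sup => //; exists n.
have h k : exists n, sup (range E) - E n <= (16^-1) ^+ k.
  have e0 : 0 < (16^-1 : R) ^+ k by rewrite exprn_gt0 ?invr_gt0.
  move/cvgrPdist_le : cE => /(_ _ e0) [n _ /(_ n)] /= hn.
  by exists n; rewrite (le_trans (ler_norm _))// hn//=.
have [m0 hm0] := choice h.
(* Summing the chosen indices makes them monotone, keeps each at least [m0 k], and the added ones
   force the k-th to be at least [k]. *)
exists (fun k => \sum_(j < k.+1) (m0 j).+1)%N; split => [k|].
  apply: (@leq_trans (\sum_(j < k.+1) 1)%N); first by rewrite sum1_card card_ord.
  exact: leq_sum.
split => k; first by rewrite [leqRHS]big_ord_recr leq_addr.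
apply: le_trans (hm0 k); rewrite lerD2l lerN2; apply: ndE.
by rewrite big_ord_recr /= addnS ltnW// ltnS leq_addl.
Qed.

Lemma cvg_normc_dist (u v : nat -> R) (a b : R) (z : R[i]) :
  u @ \oo --> a -> v @ \oo --> b ->
  (normc (Complex (u n) (v n) - z) ^+ 2)%:E @[n --> \oo] -->
  (normc (Complex a b - z) ^+ 2)%:E.
Proof.
move=> ua vb; apply: cvg_EFin; first exact: nearW.
under eq_fun do rewrite /= normc_sqr !ReD !ImD ReN ImN /= !expr2.
rewrite normc_sqr !ReD !ImD ReN ImN /= !expr2.
by apply: cvgD; apply: cvgM; apply: cvgB => //; exact: cvg_cst.
Qed.

End L2.

(** * Square-summable coefficients have a Fourier sum *)

Section RieszFischer.
Context {R : realType}.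
Local Notation muT := (@torus_measure R).
Local Notation normc := (@Normc.normc R).

Lemma sqr_Re_le_normc (z : R[i]) : complex.Re z ^+ 2 <= normc z ^+ 2.
Proof. by rewrite normc_sqr lerDl sqr_ge0. Qed.
Lemma sqr_Im_le_normc (z : R[i]) : complex.Im z ^+ 2 <= normc z ^+ 2.
Proof. by rewrite normc_sqr lerDr sqr_ge0. Qed.

Lemma increments_cvg_re_im (z : nat -> R[i]) (H : R) :
  (forall k, 4 ^+ k * normc (z k.+1 - z k) ^+ 2 <= H) ->
  cvgn (fun k => complex.Re (z k)) /\ cvgn (fun k => complex.Im (z k)).
Proof.
move=> h.
have aux (x : R) k : x ^+ 2 <= normc (z k.+1 - z k) ^+ 2 ->
    `|x| <= Num.sqrt H * (2^-1) ^+ k.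
  move=> hx.
  have H0 : 0 <= H by rewrite (le_trans _ (h 0%N))// expr0 mul1r sqr_ge0.
  rewrite exprVn ler_pdivlMr ?exprn_gt0//.
  rewrite -(@ler_pXn2r _ 2)// ?nnegrE ?sqrtr_ge0 ?mulr_ge0 ?exprn_ge0//.
  rewrite sqr_sqrtr// exprMn real_normK ?num_real// -exprM mulnC exprM mulrC.
  apply: le_trans (h k).
  by rewrite (_ : 2 ^+ 2 = 4) ?ler_pM2l// ?exprn_gt0//; ring.
split; apply: (@geometric_increments_cvg _ _ (Num.sqrt H)) => k; apply: aux.
  by rewrite -ReN -ReD sqr_Re_le_normc.
by rewrite -ImN -ImD sqr_Im_le_normc.
Qed.

(** Along the sparse subsequence the weighted squared increments have a finite total integral, hence
    are summable at almost every point, and there the increments decay geometrically. Fatou's lemma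
    then bounds the squared distance from the limit to the partial sum [N] by the tail energy, for
    every [N] and not only along the subsequence. *)
Lemma riesz_fischer c (B : R) : (forall N, energy c (modes N) <= B) ->
  exists f : R -> R[i], is_fourier_sum c f.
Proof.
move=> EB; pose E N := energy c (modes N).
have ndE : nondecreasing_seq E by exact: energy_modes_nd.
have ubE : has_ubound (range E) by exists B => _ [n _ <-]; exact: EB.
have [m [mk [mS mE]]] := fast_subsequence ndE ubE.
pose S := sup (range E).
have supE n : E n <= S by apply: ub_le_sup => //; exists n.
pose u k x := trig c (modes (m k)) x.
have mu k : measurable_complex setT (u k) by exact: measurable_trig.
pose D k x : R := 4 ^+ k * normc (u k.+1 x - u k x) ^+ 2.
have D0 k x : 0 <= D k x by rewrite mulr_ge0 ?exprn_ge0 ?normc_ge0.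
have mB k (v : R -> R[i]) : measurable_complex setT v ->
    measurable_complex setT (fun x => u k x - v x).
  by move=> mv; apply: measurable_complexD => //; exact: measurable_complexN.
have mD k : measurable_fun setT (fun x => (D k x)%:E).
  apply/measurable_EFinP; apply: measurable_funM => //.
  exact/measurable_funX/measurable_normc/mB.
pose h x := (\sum_(k <oo) (D k x)%:E)%E.
have mh : measurable_fun setT h.
  by apply: ge0_emeasurable_sum => // k x _ _; rewrite lee_fin.
have intD k : (\int[muT]_x (D k x)%:E <= (2 * pi * (4^-1) ^+ k)%:E)%E.
  under eq_integral do rewrite /D EFinM.
  rewrite ge0_integralZl_EFin//; last 2 first.
  - by move=> x _; rewrite lee_fin sqr_ge0.
  - exact/measurable_normcX/mB.
  under eq_integral do rewrite trig_modesB//.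
  rewrite trig_parseval ?uniq_high// -EFinM lee_fin.
  rewrite mulrCA ler_pM2l ?mulr_gt0 ?pi_gt0//.
  rewrite -energy_modesB//.
  apply: (@le_trans _ _ (4 ^+ k * (16^-1) ^+ k)).
    rewrite ler_pM2l ?exprn_gt0// (le_trans _ (mE k))// lerD2r; exact: supE.
  by rewrite -exprMn (_ : 4 * 16^-1 = 4^-1)//; field.
have inth : (\int[muT]_x h x < +oo)%E.
  rewrite integral_nneseries//; last by move=> k x _; rewrite lee_fin.
  apply: (@le_lt_trans _ _ (\sum_(k <oo) (2 * pi * (4^-1) ^+ k)%:E)%E).
    by apply: lee_nneseries => [k _ _|k _]; [apply: integral_ge0 => x _;
      rewrite lee_fin|exact: intD].
  have g4 : `|4^-1 : R| < 1 by rewrite ger0_norm// invf_lt1// ltr1n.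
  have -> : (\sum_(k <oo) (2 * pi * (4^-1) ^+ k)%:E)%E = (2 * pi * (1 - 4^-1)^-1 :
    R)%:E.
    apply/cvg_lim => //.
    rewrite (_ : (fun n => _) = EFin \o series (geometric (2 * pi : R) 4^-1));
      last first.
      by apply/funext => n; rewrite /= sumEFin.
    apply: cvg_EFin; first exact: nearW.
    exact: cvg_geometric_series.
  exact: ltry.
have hfin : {ae muT, forall x, setT x -> h x \is a fin_num}.
  apply: integrable_ae => //; apply/integrableP; split => //.
  have h0 x : (0 <= h x)%E by apply: nneseries_ge0 => k _ _; rewrite lee_fin; exact: D0.
  by under eq_integral do rewrite gee0_abs//.
(* An upper limit exists at every point, so the limit function is measurable on the whole line;
   where the subsequence diverges its value is irrelevant. *)
pose fR x := fine (limn_esup (fun k => (complex.Re (u k x))%:E)).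
pose fI x := fine (limn_esup (fun k => (complex.Im (u k x))%:E)).
pose f x : R[i] := Complex (fR x) (fI x).
have mf : measurable_complex setT f.
  split.
    apply: (measurableT_comp (@fine_measurable R setT measurableT)).
    apply: measurable_fun_limn_esup => k; apply/measurable_EFinP; exact: (mu k).1.
  apply: (measurableT_comp (@fine_measurable R setT measurableT)).
  apply: measurable_fun_limn_esup => k; apply/measurable_EFinP; exact: (mu k).2.
have cvgf : {ae muT, forall x,
   (fun k => complex.Re (u k x)) @ \oo --> fR x /\ (fun k => complex.Im (u k x)) @
     \oo --> fI x}.
  apply: negligibleS hfin => x /= + hfx; apply; have hx := hfx I => {hfx}.
  have [|cr ci] := @increments_cvg_re_im (u ^~ x) (fine (h x)).
    by move=> k; rewrite -lee_fin fineK//; exact: (@term_le_eseries R (D ^~ x)).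
  have aux (v : R^nat) : cvgn v -> v @ \oo --> fine (limn_esup (EFin \o v)).
    move=> cv; rewrite (cvg_limn_einf_sup (_ : _ --> (limn v)%:E)).2 //.
    by apply: cvg_EFin => //; exact: nearW.
  by split; apply: aux.
exists f; split.
  by split; apply: measurable_funTS; [exact: mf.1|exact: mf.2].
apply/LnormT2_cvg0P.
have key N : (\int[muT]_x (normc (f x - fourier_partial c N x) ^+ 2)%:E <= (2 * pi
  * (S - E N))%:E)%E.
  (* The shift by [N] guarantees [N <= m (k + N)], so that the difference is a high part and
     Parseval applies to it. *)
  pose F k x := (normc (u (k + N)%N x - trig c (modes N) x) ^+ 2)%:E.
  have mF k : measurable_fun setT (F k).
    by apply/measurable_normcX/mB; exact: measurable_trig.
  have F0 k x : (0 <= F k x)%E by rewrite lee_fin sqr_ge0.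
  under eq_integral do rewrite fourier_partialE.
  apply: (@le_trans _ _ (\int[muT]_x limn_einf (F ^~ x))%E).
    apply: ae_ge0_le_integral => //.
    - by move=> x _; rewrite lee_fin sqr_ge0.
    - apply/measurable_normcX/measurable_complexD => //.
      by apply: measurable_complexN; exact: measurable_trig.
    - by move=> x _; exact: limn_einf_ge0.
    - exact: measurable_limn_einf.
    - apply: negligibleS cvgf => x /= + cx; apply => _; have {cx}[cr ci] := cx.
      rewrite (cvg_limn_einf_sup (_ : F ^~ x @ \oo --> (normc (f x - trig c (modes
        N) x) ^+ 2)%:E)).1 //.
      have := @cvg_normc_dist R _ _ _ _ (trig c (modes N) x) cr ci.
      rewrite -(cvg_shiftn N) => hN; rewrite (_ : F ^~ x = [sequence (normc
        (Complex (complex.Re (u (n + N)%N x))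
        (complex.Im (u (n + N)%N x)) - trig c (modes N) x) ^+ 2)%:E]_n)//.
      by apply/funext => k; rewrite /F /=; case: (u _ x).
  apply: le_trans.
    by apply: fatou.
  apply: limn_einf_le_cst => k.
  have Nm : (N <= m (k + N)%N)%N by rewrite (leq_trans _ (mk _))// leq_addl.
  rewrite /F; under eq_integral do rewrite trig_modesB//.
  rewrite trig_parseval ?uniq_high// lee_fin ler_pM2l ?mulr_gt0 ?pi_gt0//.
  rewrite -energy_modesB// lerD2r; exact: supE.
have I0 N : (0 <= \int[muT]_x (normc (f x - fourier_partial c N x) ^+ 2)%:E)%E.
  by apply: integral_ge0 => x _; rewrite lee_fin sqr_ge0.
apply/cvge0_ge0P => // e e0.
have cE : E @ \oo --> S := nondecreasing_cvgn ndE ubE.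
have e1 : 0 < e / (2 * pi) by rewrite divr_gt0// mulr_gt0// pi_gt0.
move/cvgrPdist_le : cE => /(_ _ e1); apply: filterS => n hn.
apply: le_trans (key n) _; rewrite lee_fin -ler_pdivlMl ?mulr_gt0 ?pi_gt0// mulrC.
exact: le_trans (ler_norm _) hn.
Qed.

End RieszFischer.

(** * Truncated quartic integrals *)

Section Trunc.
Context {R : realType}.
Local Notation muT := (@torus_measure R).
Local Notation normc := (@Normc.normc R).

Lemma expeR_cvg (u : (\bar R)^nat) (l : \bar R) : (forall n, u n \is a fin_num) ->
  l != -oo%E -> u @ \oo --> l -> (fun n => expeR (u n)) @ \oo --> expeR l.
Proof.
move=> uf; case: l => [l _ ul|_ uy|//].
  rewrite (_ : (fun n => _) = EFin \o (expR \o (fine \o u))); last first.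
    by apply/funext => n /=; rewrite -[in LHS](fineK (uf n)).
  apply: cvg_EFin; first exact: nearW.
  move/fine_cvgP : ul => [_ ul].
  by apply: cvg_comp ul _; exact: continuous_expR.
apply/cvgeyPge => A.
move/cvgeyPge : uy => /(_ A); apply: filterS => n An.
rewrite -(fineK (uf n)) in An *; rewrite /= !lee_fin in An *.
by apply: le_trans An _; apply: le_trans (expR_ge1Dx _); rewrite lerDr.
Qed.

(* Unlike [normc z ^+ 4], this is Lipschitz in [z], so that its integral is
   continuous for mean-square convergence. *)
Definition trunc4 (K : R) (z : R[i]) : R := Num.min (normc z) K ^+ 4.

Lemma trunc4_ge0 K z : 0 <= trunc4 K z.
Proof. by rewrite /trunc4 exprn_even_ge0. Qed.

Lemma trunc4_le K z : 0 <= K -> trunc4 K z <= K ^+ 4.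
Proof. by move=> K0; rewrite lerXn2r ?nnegrE ?le_min ?normc_ge0 ?K0// ge_min lexx
  orbT. Qed.

Lemma trunc4_le_normc K z : 0 <= K -> trunc4 K z <= normc z ^+ 4.
Proof. by move=> K0; rewrite lerXn2r ?nnegrE ?le_min ?normc_ge0 ?K0// ge_min lexx. Qed.

(** [trunc4 K] is Lipschitz with constant 4 K^3, and expanding (e - 2 K^3 t)^2 >= 0 gives 4 K^3 t <=
    e + 4 K^6 t^2 / e. The distance is thus traded for its square, the quantity that mean-square
    convergence controls. *)
Lemma trunc4_dist K e z w : 0 <= K -> 0 < e ->
  trunc4 K z <= trunc4 K w + e + 4 * K ^+ 6 / e * normc (z - w) ^+ 2.
Proof.
move=> K0 e0; rewrite /trunc4.
set a := Num.min _ _; set b := Num.min _ _; set t := normc (z - w).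
have a0 : 0 <= a by rewrite le_min normc_ge0.
have b0 : 0 <= b by rewrite le_min normc_ge0.
have aK : a <= K by rewrite ge_min lexx orbT.
have bK : b <= K by rewrite ge_min lexx orbT.
have t0 : 0 <= t := normc_ge0 _.
have abt : a <= b + t.
  have := ler_dist_normc z w; rewrite ler_norml => /andP[_]; rewrite -/t => zw.
  rewrite /b minEle; case: ifP => _.
    by rewrite ge_min; apply/orP; left; lra.
  by rewrite (le_trans aK)// lerDl.
have h1 : a ^+ 4 <= b ^+ 4 + 4 * K ^+ 3 * t.
  have [ab|ba] := leP a b.
    by rewrite (le_trans (_ : _ <= b ^+ 4)) ?lerXn2r// lerDl !mulr_ge0// exprn_ge0.
  have -> : a ^+ 4 = b ^+ 4 + (a ^+ 3 + a ^+ 2 * b + a * b ^+ 2 + b ^+ 3) * (a - b)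
    by ring.
  rewrite lerD2l; apply: ler_pM.
  - by rewrite !addr_ge0 ?mulr_ge0 ?exprn_ge0.
  - by rewrite subr_ge0 ltW.
  - have -> : 4 * K ^+ 3 = K ^+ 3 + K ^+ 2 * K + K * K ^+ 2 + K ^+ 3 by ring.
    rewrite !lerD// ?lerXn2r ?ler_pM ?exprn_ge0// lerXn2r//.
  - by rewrite lerBlDl.
apply: le_trans h1 _; rewrite -addrA lerD2l -subr_ge0.
have -> : e + 4 * K ^+ 6 / e * t ^+ 2 - 4 * K ^+ 3 * t = e^-1 * ((e - 2 * K ^+ 3 *
  t) ^+ 2).
  by field; rewrite gt_eqF.
by rewrite mulr_ge0 ?sqr_ge0// invr_ge0 ltW.
Qed.

Lemma measurable_trunc4 d (X : measurableType d) (D : set X) K (f : X -> R[i]) :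
  measurable_complex D f -> measurable_fun D (fun x => (trunc4 K (f x))%:E).
Proof.
move=> mf; apply/measurable_EFinP/measurable_funX; apply: measurable_minr => //.
exact: measurable_normc.
Qed.

Definition trunc_integral (K : R) (N : nat) (c : int -> R[i]) : \bar R :=
  (\int[muT]_x (trunc4 K (trig c (modes N) x))%:E)%E.

Lemma trunc_integral_ge0 K N c : (0 <= trunc_integral K N c)%E.
Proof. by apply: integral_ge0 => x _; rewrite lee_fin trunc4_ge0. Qed.

Let mtorus : measurable (torus : set (measurableTypeR R)).
Proof. exact: measurable_itv. Qed.

Let muTtorus : muT torus = (2 * pi)%:E.
Proof. by rewrite -torus_measureT /torus_measure/= /mrestr setTI setIid. Qed.

Lemma integral_trunc4_le K (f : R -> R[i]) : 0 <= K -> measurable_complex torus f ->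
  (\int[muT]_x (trunc4 K (f x))%:E <= (K ^+ 4 * (2 * pi))%:E)%E.
Proof.
move=> K0 mf.
rewrite ge0_integral_torus_measure; last 2 first.
- by move=> x; rewrite lee_fin trunc4_ge0.
- exact: measurable_trunc4.
apply: (@le_trans _ _ (\int[muT]_(x in torus) cst (K ^+ 4)%:E x)%E).
  apply: ge0_le_integral => //.
  - by move=> x _; rewrite lee_fin trunc4_ge0.
  - exact: measurable_trunc4.
  - by move=> x _; rewrite lee_fin trunc4_le.
by rewrite integral_cst// muTtorus -EFinM.
Qed.

Lemma integral_trunc4_dist K e (f g : R -> R[i]) : 0 <= K -> 0 < e ->
  measurable_complex torus f -> measurable_complex torus g ->
  (\int[muT]_x (trunc4 K (f x))%:E <= \int[muT]_x (trunc4 K (g x))%:E + (e * (2 *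
    pi))%:E +
    (4 * K ^+ 6 / e)%:E * \int[muT]_x (normc (f x - g x) ^+ 2)%:E)%E.
Proof.
move=> K0 e0 mf mg.
have mfg : measurable_complex torus (fun x => f x - g x).
  by apply: measurable_complexD => //; exact: measurable_complexN.
have C0 : 0 <= 4 * K ^+ 6 / e by rewrite !mulr_ge0 ?exprn_ge0 ?invr_ge0 ?(ltW e0).
rewrite !ge0_integral_torus_measure; try (by move=> x;
  rewrite lee_fin ?trunc4_ge0 ?sqr_ge0);
  try (by apply: measurable_trunc4); try (by apply: measurable_normcX).
rewrite [(e * _)%:E]EFinM -muTtorus -(integral_cst muT mtorus).
rewrite -ge0_integralZl_EFin//; last 2 first.
- by move=> x _; rewrite lee_fin sqr_ge0.
- exact: measurable_normcX.
rewrite -ge0_integralD//; last 3 first.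
- by move=> x _; rewrite lee_fin trunc4_ge0.
- exact: measurable_trunc4.
- by move=> x _; rewrite lee_fin ltW.
rewrite -ge0_integralD//; last 4 first.
- by move=> x _; rewrite -EFinD lee_fin addr_ge0 ?trunc4_ge0// ltW.
- apply: emeasurable_funD => //; exact: measurable_trunc4.
- by move=> x _; rewrite -EFinM lee_fin mulr_ge0 ?sqr_ge0.
- apply: measurable_funeM; exact: measurable_normcX.
apply: ge0_le_integral => //.
- by move=> x _; rewrite lee_fin trunc4_ge0.
- exact: measurable_trunc4.
- apply: emeasurable_funD; first by apply: emeasurable_funD => //;
  exact: measurable_trunc4.
  apply: measurable_funeM; exact: measurable_normcX.
- by move=> x _; rewrite -EFinM -!EFinD lee_fin trunc4_dist.
Qed.

Lemma trunc_integral_le K N c : 0 <= K ->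
  (trunc_integral K N c <= (K ^+ 4 * (2 * pi))%:E)%E.
Proof.
move=> K0; apply: integral_trunc4_le => //.
by have [mr mi] := measurable_trig c (modes N); split; apply: measurable_funTS.
Qed.

Lemma trunc_integral_fin K N c : 0 <= K -> trunc_integral K N c \is a fin_num.
Proof.
move=> K0; rewrite ge0_fin_numE ?trunc_integral_ge0//.
by rewrite (le_lt_trans (trunc_integral_le _ _ K0)) ?ltry.
Qed.

Lemma trunc_integral_cvg K c f : 0 <= K -> is_fourier_sum c f ->
  trunc_integral K N c @[N --> \oo] --> (\int[muT]_x (trunc4 K (f x))%:E)%E.
Proof.
move=> K0 [mf /LnormT2_cvg0P cf].
set G := (\int[muT]_x _)%E.
have G0 : (0 <= G)%E by apply: integral_ge0 => x _; rewrite lee_fin trunc4_ge0.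
have Gf : G \is a fin_num.
  by rewrite ge0_fin_numE// (le_lt_trans (integral_trunc4_le K0 mf)) ?ltry.
pose J N := (\int[muT]_x (normc (f x - fourier_partial c N x) ^+ 2)%:E)%E.
have J0 N : (0 <= J N)%E by apply: integral_ge0 => x _; rewrite lee_fin sqr_ge0.
rewrite -(fineK Gf); apply/fine_cvgP; split; first by apply: nearW => N;
  exact: trunc_integral_fin.
apply/cvgrPdist_le => e e0.
(* Over the torus [e1] integrates to [e / 2], and [dl] keeps the quadratic term below the other
   half; the denominator [C + 1] covers [C = 0], that is [K = 0]. *)
pose e1 := e / (4 * pi).
have pi0 := pi_gt0 R.
have e10 : 0 < e1 by rewrite divr_gt0// mulr_gt0.
pose C := 4 * K ^+ 6 / e1.
have C0 : 0 <= C by rewrite !mulr_ge0 ?exprn_ge0 ?invr_ge0 ?(ltW e10).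
pose dl := e / 2 / (C + 1).
have dl0 : 0 < dl by rewrite !divr_gt0// ltr_wpDl.
have := (cvge0_ge0P J0).1 cf dl dl0; apply: filterS => N JN.
have mt : measurable_complex torus (trig c (modes N)).
  by have [mr mi] := measurable_trig c (modes N); split; apply: measurable_funTS.
have JNf : J N \is a fin_num by rewrite ge0_fin_numE// (le_lt_trans JN) ?ltry.
have JE : J N = (\int[muT]_x (normc (f x - trig c (modes N) x) ^+ 2)%:E)%E.
  by apply: eq_integral => x _; rewrite fourier_partialE.
have JE' : J N = (\int[muT]_x (normc (trig c (modes N) x - f x) ^+ 2)%:E)%E.
  by rewrite JE; apply: eq_integral => x _; rewrite -normc_opp opprB.
have h1 := integral_trunc4_dist K0 e10 mf mt.
have h2 := integral_trunc4_dist K0 e10 mt mf.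
rewrite -/G -/(trunc_integral K N c) -?JE -?JE' -/C in h1 h2.
have tf := trunc_integral_fin N c K0.
rewrite -(fineK tf) -(fineK Gf) -(fineK JNf) -EFinM -!EFinD lee_fin in h1.
rewrite -(fineK tf) -(fineK Gf) -(fineK JNf) -EFinM -!EFinD lee_fin in h2.
rewrite -(fineK JNf) lee_fin in JN.
have e1E : e1 * (2 * pi) = e / 2.
  have aux (x y : R) : y != 0 -> x / (4 * y) * (2 * y) = x / 2 by move=> y0; field.
  by apply: aux; rewrite gt_eqF.
have CE : C * fine (J N) <= e / 2.
  apply: (@le_trans _ _ ((C + 1) * dl)); last by rewrite /dl mulrC divfK// gt_eqF//
    ltr_wpDl.
  by rewrite ler_pM// ?fine_ge0// lerDl.
rewrite e1E in h1 h2.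
by rewrite /= ler_norml; apply/andP; split; lra.
Qed.

Lemma trunc4_mono (K L : R) z : 0 <= K -> K <= L -> trunc4 K z <= trunc4 L z.
Proof.
move=> K0 KL; rewrite /trunc4 lerXn2r// ?nnegrE ?le_min ?normc_ge0 ?K0 ?(le_trans K0)//.
by rewrite ge_min lexx /= ge_min KL orbT.
Qed.

(** At each point the truncation increases with [K] and is eventually inactive, so monotone
    convergence applies. The limit is allowed to be infinite. *)
Lemma integral_trunc4_cvg (f : R -> R[i]) : measurable_complex torus f ->
  (\int[muT]_x (trunc4 K%:R (f x))%:E)%E @[K --> \oo] --> (LnormT 4 f ^+ 4)%E.
Proof.
move=> mf; rewrite (@LnormTX R 4)//.
rewrite ge0_integral_torus_measure; last 2 first.
- by move=> x; rewrite lee_fin exprn_ge0// normc_ge0.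
- exact: measurable_normcX.
rewrite (_ : (fun K : nat => _) = fun K : nat => (\int[muT]_(x in torus) (trunc4
  K%:R (f x))%:E)%E); last first.
  apply/funext => K; rewrite ge0_integral_torus_measure//.
  - by move=> x; rewrite lee_fin trunc4_ge0.
  - exact: measurable_trunc4.
rewrite (_ : (fun x => _) = fun x => limn (fun K : nat => (trunc4 K%:R (f x))%:E));
  last first.
  apply/funext => x; apply/esym/cvg_lim => //.
  apply: cvg_EFin; first exact: nearW.
  apply: cvg_near_cst; near=> K.
  rewrite /= /trunc4 min_l//; near: K; exact: nbhs_infty_ger.
apply: cvg_monotone_convergence => //.
- by move=> K; exact: measurable_trunc4.
- by move=> K x _; rewrite lee_fin trunc4_ge0.
- by move=> x _ a b ab; rewrite lee_fin trunc4_mono// ler_nat.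
Unshelve. all: by end_near. Qed.

End Trunc.

(** * Gaussian exponential moments *)

Section Transfer.
Local Open Scope ereal_scope.
Context d1 d2 (S : measurableType d1) (Y : measurableType d2) (R : realType).
Variables (m : {measure set S -> \bar R}) (nu : {measure set Y -> \bar R}).
Variables (X : S -> Y) (H : S -> R) (k : R).
Hypotheses (mX : measurable_fun setT X) (mH : measurable_fun setT H).
Hypothesis H0 : forall s, (0 <= H s)%R.
Hypothesis XH : forall B, measurable B ->
  \int[m]_s (\1_B (X s) * H s)%:E = k%:E * nu B.

Import HBNNSimple.

Let transfer_nnsfun (h : {nnsfun Y >-> R}) :
  \int[m]_s (h (X s) * H s)%:E = k%:E * \int[nu]_y (h y)%:E.
Proof.
have mI y : measurable_fun setT (fun s => \1_(h @^-1` [set y]) (X s) : R).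
  by apply: (measurableT_comp _ mX); exact: measurable_indic.
have E s : (h (X s) * H s)%:E =
    (\sum_(y \in range h) (y%:E * (\1_(h @^-1` [set y]) (X s) * H s)%:E)).
  rewrite fimfunE EFinM -fsumEFin//.
  rewrite muleC ge0_mule_fsumr; last first.
    by move=> y; rewrite EFinM nnfun_muleindic_ge0.
  by apply: eq_fsbigr => y _; rewrite muleC -!EFinM mulrA.
under eq_integral do rewrite E.
rewrite ge0_integral_fsum//; last 2 first.
- move=> y; apply: measurable_funeM; apply/measurable_EFinP.
  exact: measurable_funM.
- move=> y s _; rewrite EFinM muleA; apply: mule_ge0; rewrite ?lee_fin//.
  exact: nnfun_muleindic_ge0.
under [in RHS]eq_integral do rewrite fimfunE -fsumEFin//.
rewrite ge0_integral_fsum//; last 2 first.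
- by move=> y; apply/measurable_EFinP; apply: measurable_funM => //.
- by move=> y s _; rewrite EFinM nnfun_muleindic_ge0.
rewrite ge0_mule_fsumr; last first.
  move=> y; apply: integral_ge0 => s _; rewrite EFinM; exact: nnfun_muleindic_ge0.
apply: eq_fsbigr => y; rewrite inE => -[t _ <-].
rewrite integralZl_indic_nnsfun//.
rewrite ge0_integralZl_EFin//; last 2 first.
- by move=> s _; rewrite lee_fin mulr_ge0.
- by apply/measurable_EFinP; exact: measurable_funM.
by rewrite XH// integral_indic// setIT muleCA.
Qed.

(** Passes from sets to functions through simple functions and monotone limits. The weight [H] lets
    one statement serve three times: for a density ([X] the identity), for the law of a random
    variable ([H] equal to 1), and for independence ([H] the product of the other factors). *)
Lemma ge0_integral_transfer (h : Y -> R) : measurable_fun setT h ->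
  (forall y, (0 <= h y)%R) ->
  \int[m]_s (h (X s) * H s)%:E = k%:E * \int[nu]_y (h y)%:E.
Proof.
move=> mh h0.
have mEh : measurable_fun setT (EFin \o h) by exact/measurable_EFinP.
pose a := nnsfun_approx measurableT mEh.
have ca y : (a n y)%:E @[n --> \oo] --> (h y)%:E.
  by apply: (cvg_nnsfun_approx measurableT mEh) => // z _; rewrite lee_fin.
have nda y i j : (i <= j)%N -> (a i y <= a j y)%R.
  by move=> ij; have /lefP := nd_nnsfun_approx measurableT mEh ij; exact.
have ma n : measurable_fun setT (a n) by [].
transitivity (limn (fun n => \int[m]_s (a n (X s) * H s)%:E)).
  rewrite -monotone_convergence//=; last 3 first.
  - move=> n; apply/measurable_EFinP; apply: measurable_funM => //.
    exact: measurableT_comp.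
  - by move=> n s _; rewrite lee_fin mulr_ge0.
  - by move=> s _ i j ij; rewrite lee_fin ler_wpM2r// nda.
  apply: eq_integral => s _; apply/esym/cvg_lim => //.
  by under eq_fun do rewrite EFinM; rewrite EFinM; exact: cvgeZr.
under eq_fun do rewrite transfer_nnsfun.
apply/cvg_lim => //; apply: cvgeZl => //.
have -> : \int[nu]_y (h y)%:E = \int[nu]_y limn (fun n => (a n y)%:E).
  by apply: eq_integral => y _; apply/esym/cvg_lim.
apply: cvg_monotone_convergence => //.
- by move=> n; exact/measurable_EFinP.
- by move=> n s _; rewrite lee_fin.
- by move=> s _ i j ij; rewrite lee_fin nda.
Qed.

End Transfer.

Section GaussianMgf.
Context {R : realType}.
Local Notation leb := (@lebesgue_measure R).

Lemma integral_indicM d (T : measurableType d) (mu : {measure set T -> \bar R})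
    (B : set T) (f : T -> R) : measurable B ->
  (\int[mu]_x (\1_B x * f x)%:E = \int[mu]_(x in B) (f x)%:E)%E.
Proof.
move=> mB; rewrite [RHS]integral_mkcond; apply: eq_integral => x _.
by rewrite patchE indicE; case: ifP => _; rewrite ?mul1r ?mul0r.
Qed.

(** Completing the square: the density tilted by exp (a x) is a constant times the normal density of
    mean [a * s ^+ 2]. *)
Lemma normal_mgf (s a : R) : s != 0 ->
  (\int[normal_prob 0 s]_x (expR (a * x))%:E = (expR (a ^+ 2 * s ^+ 2 / 2))%:E)%E.
Proof.
move=> s0.
have -> : (\int[normal_prob 0 s]_x (expR (a * x))%:E =
    \int[leb]_x (expR (a * x) * normal_pdf 0 s x)%:E)%E.
  have /= := @ge0_integral_transfer _ _ _ _ R leb (normal_prob 0 s) id (normal_pdf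
    0 s) 1
    _ _ _ _ (fun x => expR (a * x)).
  rewrite mul1e => -> //.
  - exact: measurable_normal_pdf.
  - by move=> x; exact: normal_pdf_ge0.
  - by move=> B mB; rewrite integral_indicM// mul1e.
  - by apply: measurableT_comp => //; exact: mulrl_measurable.
transitivity (\int[leb]_x ((expR (a ^+ 2 * s ^+ 2 / 2))%:E * (normal_pdf (a * s ^+
  2) s x)%:E))%E.
  apply: eq_integral => x _; rewrite -EFinM; congr EFin.
  rewrite /normal_pdf (negbTE s0) /normal_fun mulrCA [RHS]mulrCA -!expRD;
    congr (_ * expR _).
  by field.
rewrite ge0_integralZl_EFin//; last 2 first.
- by move=> x _; rewrite lee_fin normal_pdf_ge0.
- by apply/measurable_EFinP; exact: measurable_normal_pdf.
by rewrite integral_normal_pdf mule1.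
Qed.

Context d (T : measurableType d) (P : probability T R).

Lemma measurable_complex_pair (Z : T -> R[i]) : measurable_complex setT Z ->
  measurable_fun setT (complex_pair \o Z).
Proof. by move=> [mr mi]; exact: measurable_fun_pair. Qed.

(** The two coordinates separate by Tonelli; each has variance 1/2, hence the 4 in the exponent. *)
Lemma gaussian_mgf (Z : T -> R[i]) (a b : R) : std_complex_gaussian P Z ->
  (\int[P]_w (expR (a * complex.Re (Z w) + b * complex.Im (Z w)))%:E =
   (expR ((a ^+ 2 + b ^+ 2) / 4))%:E)%E.
Proof.
move=> [mZ lawZ].
pose N : {sigma_finite_measure set (measurableTypeR R) -> \bar R} :=
  normal_prob 0 (Num.sqrt 2^-1 : R).
have s0 : Num.sqrt 2^-1 != 0 :> R by rewrite gt_eqF// sqrtr_gt0.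
pose h (y : R * R) := expR (a * y.1 + b * y.2).
have mh : measurable_fun setT h.
  apply: measurableT_comp => //; apply: measurable_funD.
    by apply: measurableT_comp; [exact: mulrl_measurable|exact: measurable_fst].
  by apply: measurableT_comp; [exact: mulrl_measurable|exact: measurable_snd].
transitivity (\int[(N \x N)%E]_y (h y)%:E)%E.
  have := @ge0_integral_transfer _ _ _ _ R P (N \x N)%E (complex_pair \o Z) (cst 1) 1
    _ _ _ _ h.
  rewrite mul1e => <-//.
  - by apply: eq_integral => w _; rewrite /= mulr1.
  - exact: measurable_complex_pair.
  - move=> B mB; rewrite mul1e; transitivity (P ((complex_pair \o Z) @^-1` B));
    last exact: lawZ.
    under eq_integral do rewrite /= mulr1.
    rewrite -[X in P X]setIT -integral_indic//.
    rewrite -[_ @^-1` _]setTI; exact: measurable_complex_pair.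
  - by move=> y; exact: expR_ge0.
transitivity (\int[N]_x fubini_F N (EFin \o h) x)%E.
  apply: fubini_tonelli1; last by move=> y; exact: expR_ge0.
  by have /measurable_EFinP := mh; exact.
rewrite /fubini_F /h /=.
have ma (c : R) : measurable_fun setT (fun x => (expR (c * x))%:E).
  by apply/measurable_EFinP; apply: measurableT_comp => //; exact: mulrl_measurable.
have s2 : Num.sqrt 2^-1 ^+ 2 = 2^-1 :> R by rewrite sqr_sqrtr.
have E x : (\int[N]_y (expR (a * x + b * y))%:E =
    (expR (b ^+ 2 / 4))%:E * (expR (a * x))%:E)%E.
  under eq_integral do rewrite expRD EFinM.
  rewrite ge0_integralZl_EFin ?expR_ge0//; last exact: ma.
  by rewrite normal_mgf// s2 muleC; congr ((expR _)%:E * _)%E; field.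
under eq_integral do rewrite E.
rewrite ge0_integralZl_EFin ?expR_ge0//; last exact: ma.
by rewrite normal_mgf// s2 -EFinM -expRD; congr (expR _)%:E; field.
Qed.

End GaussianMgf.

(** * From independence of events to expectations of products *)

Section Independence.
Context {R : realType} d (T : measurableType d) (P : probability T R).
Variable g : int -> T -> R[i].
Hypothesis mg : forall n, measurable_complex setT (g n).
Hypothesis indep : mutually_independent P g.
Local Notation X n := (complex_pair \o g n).

Let mX n : measurable_fun setT (X n).
Proof. exact: measurable_complex_pair. Qed.

Let X_mixin n := isMeasurableFun.Build _ _ _ _ _ (mX n).
Let X_pack n : {mfun T >-> (R * R)%type} := HB.pack (X n) (X_mixin n).

Let mXB n B : measurable B -> measurable (X n @^-1` B).
Proof. by move=> mB; rewrite -[_ @^-1` _]setTI; exact: mX. Qed.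

Let indic_prod (t : seq int) (B : int -> set (R * R)) w :
  \prod_(n <- t) \1_(B n) (X n w) =
  \1_(\bigcap_(n in [set` [fset n in t]%fset]) (X n @^-1` B n)) w :> R.
Proof.
rewrite indicE; have [|] := boolP (w \in _).
  rewrite inE => h; rewrite big_seq big1// => n nt.
  by rewrite indicE mem_set//; apply: h; rewrite /= !inE.
rewrite notin_setE /bigcap /= => /existsNP[n /not_implyP[]].
rewrite !inE => nt wB.
rewrite (big_rem n)//= indicE memNset ?mul0r//.
Qed.

(* Induction on [s]: the functions [h n] are introduced one at a time in place of
   the indicators that mutual independence is about. *)
Lemma integral_prod_indep (h : int -> R * R -> R) (e : int -> R) :
  (forall n, measurable_fun setT (h n)) -> (forall n y, 0 <= h n y) ->
  (forall n, \int[P]_w (h n (X n w))%:E = (e n)%:E)%E ->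
  forall (s t : seq int) (B : int -> set (R * R)), uniq (s ++ t) ->
  (forall n, measurable (B n)) ->
  (\int[P]_w ((\prod_(n <- s) h n (X n w)) * \prod_(n <- t) \1_(B n) (X n w))%:E =
   (\prod_(n <- s) e n)%:E * \prod_(n <- t) P (X n @^-1` B n))%E.
Proof.
move=> mh h0 he; elim=> [|n s ih] t B /= us mB.
  rewrite big_nil mul1e; under eq_integral do rewrite big_nil mul1r indic_prod.
  rewrite integral_indic//; last first.
    by apply: fin_bigcap_measurable => // n _; exact: mXB.
  rewrite setIT; apply: (etrans (indep [fset n in t]%fset mB)); apply: perm_big;
    apply: uniq_perm => // m.
  by rewrite !inE.
case/andP: us => nst us.
have Pfin : (\prod_(m <- t) P (X m @^-1` B m) \is a fin_num)%E.
  by apply: prode_fin_num => m _; apply: fin_num_measure; exact: mXB.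
pose k := \prod_(m <- s) e m * fine (\prod_(m <- t) P (X m @^-1` B m))%E.
pose H w := (\prod_(m <- s) h m (X m w)) * \prod_(m <- t) \1_(B m) (X m w).
have mh' m : measurable_fun setT (fun w => h m (X m w)) by exact: measurableT_comp.
have mI m : measurable_fun setT (fun w => \1_(B m) (X m w) : R).
  by apply: (measurableT_comp _ (mX m)); exact: measurable_indic.
have mH : measurable_fun setT H.
  by apply: measurable_funM; apply: measurable_prod.
have H0 w : 0 <= H w by rewrite mulr_ge0// prodr_ge0.
(* One function at a time: it suffices to treat an indicator in place of [h n], with the remaining
   factors frozen in the weight [H]. *)
have E : (forall C, measurable C ->
      \int[P]_w (\1_C (X n w) * H w)%:E = k%:E * P (X n @^-1` C))%E ->
    (\int[P]_w (h n (X n w) * H w)%:E = k%:E * (e n)%:E)%E.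
  move=> XH.
  have := @ge0_integral_transfer _ _ _ _ R P (pushforward P (X_pack n)) (X n) H k
    (mX n) mH H0 XH (h n) (mh n) (h0 n).
  move->; congr (_ * _)%E; rewrite -(he n).
  apply: (ge0_integral_pushforward (mX n) P measurableT).
    exact/measurable_EFinP.
  by move=> y _; rewrite lee_fin.
under eq_integral do rewrite big_cons -mulrA.
rewrite E//.
- by rewrite big_cons /k EFinM fineK// EFinM muleAC [(_ * (e n)%:E)%E]muleC.
- move=> B' mB'.
  (* The index [n] moves from the list of functions to the list of indicators, where the induction
     hypothesis applies. As [n] is not in [t], overriding [B] at [n] leaves the other events
     unchanged. *)
  pose B2 m := if m == n then B' else B m.
  have nt : n \notin t by move: nst; rewrite mem_cat negb_or => /andP[].
  have tE V (idx : V) op (F : int -> set (R * R) -> V) :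
      \big[op/idx]_(m <- t) F m (B2 m) = \big[op/idx]_(m <- t) F m (B m).
    apply: eq_big_seq => m mt; rewrite /B2; case: eqP => // mn.
    by rewrite -mn mt in nt.
  have := ih (n :: t) B2.
  rewrite big_cons (tE _ _ _ (fun m C => P (X m @^-1` C))) /B2 eqxx => ihn.
  under eq_integral do rewrite /H mulrCA.
  rewrite /k EFinM fineK// -muleA [Y in (_ * Y)%E]muleC.
  rewrite -ihn.
  - apply: eq_integral => w _.
    rewrite big_cons (tE _ _ _ (fun m C => \1_C (X m w))) /B2 eqxx//.
  - by rewrite uniq_catC /= uniq_catC us mem_cat orbC -mem_cat nst.
  - by move=> m; case: ifP.
Qed.

Hypothesis gauss : forall n, std_complex_gaussian P (g n).

Lemma mgf_gaussian_sum (a b : int -> R) (s : seq int) : uniq s ->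
  (\int[P]_w (expR (\sum_(n <- s) (a n * complex.Re (g n w) + b n * complex.Im (g n
    w))))%:E =
   (expR ((\sum_(n <- s) (a n ^+ 2 + b n ^+ 2)) / 4))%:E)%E.
Proof.
move=> us.
pose h n (y : R * R) := expR (a n * y.1 + b n * y.2).
have mh n : measurable_fun setT (h n).
  apply: measurableT_comp => //; apply: measurable_funD.
    by apply: measurableT_comp; [exact: mulrl_measurable|exact: measurable_fst].
  by apply: measurableT_comp; [exact: mulrl_measurable|exact: measurable_snd].
have := @integral_prod_indep h (fun n => expR ((a n ^+ 2 + b n ^+ 2) / 4)) mh
  (fun n y => expR_ge0 _) (fun n => gaussian_mgf _ _ (gauss n)) s [::] (fun=> setT).
rewrite cats0 us => /(_ isT (fun=> measurableT)).
rewrite big_nil mule1 -expR_sum -mulr_suml => <-.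
by apply: eq_integral => w _; rewrite big_nil mulr1 -expR_sum.
Qed.

End Independence.

(** * Moments of the high frequencies *)

Section Elementary.
Context {R : realType}.
Implicit Types (x y a b : R).

Lemma expR_ge_pow x n : 0 <= x -> x ^+ n / n`!%:R <= expR x.
Proof.
case: n => [|n] x0; first by rewrite expr0 divr1 (le_trans _ (expR_ge1Dx x))// lerDl.
by apply: le_trans (expR_ge1Dxn n x0); rewrite lerDr.
Qed.

Lemma even_pow_le_cosh x j : x ^+ j.*2 <= (j.*2)`!%:R * (expR x + expR (- x)).
Proof.
have -> : x ^+ j.*2 = `|x| ^+ j.*2 by rewrite -normrX ger0_norm// exprn_even_ge0//
  odd_double.
rewrite -ler_pdivrMl ?ltr0n ?fact_gt0// mulrC.
apply: le_trans (expR_ge_pow _ (normr_ge0 x)) _.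
have [x0|x0] := ger0P x; [rewrite lerDl|rewrite lerDr]; exact: expR_ge0.
Qed.

Lemma fact_leq_expn n : (n`! <= n ^ n)%N.
Proof.
elim: n => // n ih; rewrite factS expnS leq_mul2l /=.
by case: n ih => // n ih; apply: leq_trans ih _; rewrite leq_exp2r.
Qed.

Lemma exprD_le_2X a b k : 0 <= a -> 0 <= b -> (a + b) ^+ k <= 2 ^+ k * (a ^+ k + b
    ^+ k).
Proof.
move=> a0 b0; wlog ab : a b a0 b0 / a <= b => [h|].
  have [/h|/ltW /h] := leP a b; first exact.
  by rewrite addrC [b ^+ k + _]addrC; exact.
apply: (@le_trans _ _ ((2 * b) ^+ k)).
  by rewrite lerXn2r ?nnegrE ?addr_ge0 ?mulr_ge0// mulrDl mul1r lerD2r.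
by rewrite exprMn ler_pM2l ?exprn_gt0// lerDr exprn_ge0.
Qed.

(* [y ^+ k.+1] lies above its tangent at [a]; written without subtraction
   because it is integrated in the extended reals. *)
Lemma power_tangent a y k : 0 <= a -> 0 <= y ->
  k.+1%:R * a ^+ k * y <= y ^+ k.+1 + k%:R * a ^+ k.+1.
Proof.
move=> a0 y0; elim: k => [|k ih]; first by rewrite expr0 mul0r addr0 !mul1r.
(* The defect at [k.+1] is [y] times the defect at [k] plus a nonnegative multiple of (y - a)^2. *)
have h : 0 <= y * (y ^+ k.+1 + k%:R * a ^+ k.+1 - k.+1%:R * a ^+ k * y).
  by rewrite mulr_ge0// subr_ge0.
rewrite -subr_ge0; apply: le_trans h _; rewrite -subr_ge0.
have -> : y ^+ k.+2 + k.+1%:R * a ^+ k.+2 - k.+2%:R * a ^+ k.+1 * y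
  - y * (y ^+ k.+1 + k%:R * a ^+ k.+1 - k.+1%:R * a ^+ k * y) =
  k.+1%:R * a ^+ k * (y - a) ^+ 2.
  rewrite -[k.+2%:R]natr1 -[k.+1%:R]natr1 !exprS. ring.
by apply: mulr_ge0; [apply: mulr_ge0 => //; exact: exprn_ge0|exact: sqr_ge0].
Qed.

Lemma perm_high_succ N M : (N <= M)%N ->
  perm_eq (high N M.+1) ([:: M.+1%:Z; - M.+1%:Z] ++ high N M).
Proof.
move=> NM; apply: uniq_perm; rewrite ?uniq_high//.
  rewrite cat_uniq uniq_high has_sym /= /high !mem_filter !mem_modes orbF negb_or
    andbT; lia.
by move=> n; rewrite mem_cat /high !mem_filter !mem_modes !inE; lia.
Qed.

Lemma high_nil N M : (M <= N)%N -> high N M = [::].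
Proof.
move=> MN; apply/eqP; rewrite -[_ == _]negbK -has_filter -all_predC; apply/allP => n.
by rewrite mem_modes /=; lia.
Qed.

(** The source of the O(1 / N) variance of the high part. *)
Lemma sum_high_le N M : (0 < N)%N ->
  \sum_(n <- high N M) (1 + n%:~R ^+ 2)^-1 <= 2 / N%:R :> R.
Proof.
move=> N0; have [MN|/ltnW NM] := leqP M N.
  by rewrite high_nil// big_nil divr_ge0.
(* The strengthened bound telescopes: the two modes of modulus M + 1 add 2 / (1 + (M + 1)^2), at
   most 2 / M - 2 / (M + 1). *)
suff : \sum_(n <- high N M) (1 + n%:~R ^+ 2)^-1 <= 2 / N%:R - 2 / M%:R :> R.
  by move=> /le_trans; apply; rewrite gerBl divr_ge0.
rewrite -(subnKC NM); elim: (M - N)%N => [|k ih].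
  by rewrite addn0 high_nil// big_nil subrr.
rewrite addnS (perm_big _ (perm_high_succ (leq_addr k N))) !big_cons /=. rewrite addrA.
apply: (le_trans (lerD (lexx _) ih)); move: (N + k)%N (leq_addr k N) => {}M {}NM.
have M0 : 0 < M%:R :> R by rewrite ltr0n (leq_trans N0).
rewrite rmorphN /= sqrrN -pmulrn -[M.+1%:R]natr1.
rewrite addrCA lerD2l -subr_ge0.
have -> : - (2 / (M%:R + 1)) - ((1 + (M%:R + 1) ^+ 2)^-1 + (1 + (M%:R + 1) ^+ 2)^-1
  - 2 / M%:R) =
  2 * (M%:R + 2) / (M%:R * (M%:R + 1) * (1 + (M%:R + 1) ^+ 2)) :> R.
  have M1 : M%:R + 1 != 0 :> R by rewrite gt_eqF// addr_gt0.
  have M2 : 1 + (M%:R + 1) ^+ 2 != 0 :> R by rewrite gt_eqF// ltr_pwDl// sqr_ge0.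
  have M3 : M%:R != 0 :> R by rewrite gt_eqF.
  by move: M%:R M1 M2 M3 => x h1 h2 h3; field; rewrite h1 h2 h3.
apply: divr_ge0; rewrite ?mulr_ge0 ?addr_ge0 ?sqr_ge0 ?(ltW M0)//.
Qed.

End Elementary.

Section RandomTrig.
Context {R : realType} d (T : measurableType d) (P : probability T R).
Variable g : int -> T -> R[i].
Hypothesis iid : iid_complex_gaussian P g.
Local Notation muT := (@torus_measure R).
Local Notation normc := (@Normc.normc R).
Local Notation coef := (random_coef g).
Local Notation jap := (@japanese R).

Let mg n : measurable_complex setT (g n). Proof. by case: (iid.1 n). Qed.

Lemma sqr_japanese n : jap n ^+ 2 = 1 + n%:~R ^+ 2.
Proof. by rewrite sqr_sqrtr// addr_ge0 ?sqr_ge0. Qed.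

Lemma random_coefE w n : coef w n = Complex (complex.Re (g n w) / jap n)
    (complex.Im (g n w) / jap n).
Proof.
rewrite /random_coef -fmorphV /=; case: (g n w) => a b /=.
by simpc.
Qed.

Lemma energy_random_coef w s : energy (coef w) s =
  \sum_(n <- s) normc (g n w) ^+ 2 / jap n ^+ 2.
Proof.
apply: eq_bigr => n _; rewrite random_coefE !normc_sqr /= !exprMn -mulrDl.
by rewrite exprVn.
Qed.

Lemma Re_trig_random w s x : complex.Re (trig (coef w) s x) =
  \sum_(n <- s) (cos (n%:~R * x) / jap n * complex.Re (g n w)
    + (- sin (n%:~R * x) / jap n) * complex.Im (g n w)).
Proof.
rewrite /trig Re_sum; apply: eq_bigr => n _; rewrite Re_mul_expi random_coefE /=.
by ring.
Qed.

Lemma Im_trig_random w s x : complex.Im (trig (coef w) s x) =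
  \sum_(n <- s) (sin (n%:~R * x) / jap n * complex.Re (g n w)
    + cos (n%:~R * x) / jap n * complex.Im (g n w)).
Proof.
rewrite /trig Im_sum; apply: eq_bigr => n _; rewrite Im_mul_expi random_coefE /=.
by ring.
Qed.

(** Joint in the sample and the point, as needed to exchange the expectation with the integral over
    the torus. *)
Lemma measurable_trig_random s :
  measurable_complex setT (fun z : T * R => trig (coef z.1) s z.2).
Proof.
have mc n (f : R -> R) (a : T -> R) : continuous f -> measurable_fun setT a ->
    measurable_fun setT (fun z : T * R => f (n%:~R * z.2) / jap n * a z.1).
  move=> cf ma; apply: measurable_funM; last exact: (measurableT_comp ma).
  apply: measurable_funM => //; apply: (measurableT_comp (continuous_measurable_fun
    cf)).
  by apply: measurable_funM => //; exact: measurable_snd.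
split.
  rewrite (_ : _ \o _ = fun z : T * R => \sum_(n <- s)
    (cos (n%:~R * z.2) / jap n * complex.Re (g n z.1)
      + (- sin (n%:~R * z.2)) / jap n * complex.Im (g n z.1))).
    apply: measurable_sum => n; apply: measurable_funD.
      apply: (mc n cos (fun w => complex.Re (g n w))); first exact: continuous_cos.
      exact: (mg n).1.
    apply: (mc n (fun y => - sin y) (fun w => complex.Im (g n w)));
      last exact: (mg n).2.
    by move=> y; apply: cvgN; exact: continuous_sin.
  by apply/funext => z /=; exact: Re_trig_random.
rewrite (_ : _ \o _ = fun z : T * R => \sum_(n <- s)
  (sin (n%:~R * z.2) / jap n * complex.Re (g n z.1)
    + cos (n%:~R * z.2) / jap n * complex.Im (g n z.1))).
  apply: measurable_sum => n; apply: measurable_funD.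
    apply: (mc n sin (fun w => complex.Re (g n w))); first exact: continuous_sin.
    exact: (mg n).1.
  apply: (mc n cos (fun w => complex.Im (g n w))); first exact: continuous_cos.
  exact: (mg n).2.
by apply/funext => z /=; exact: Im_trig_random.
Qed.

Let var s : R := \sum_(n <- s) (1 + n%:~R ^+ 2)^-1.

(** Since cos^2 + sin^2 = 1, the variance does not depend on [x]: the Gaussian law is invariant
    under rotating each coefficient. *)
Lemma mgf_Re_trig s x t : uniq s ->
  (\int[P]_w (expR (t * complex.Re (trig (coef w) s x)))%:E = (expR (t ^+ 2 * var s
    / 4))%:E)%E.
Proof.
move=> us.
have E : \sum_(n <- s) ((t * (cos (n%:~R * x) / jap n)) ^+ 2 +
    (t * (- sin (n%:~R * x) / jap n)) ^+ 2) = t ^+ 2 * var s.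
  rewrite /var mulr_sumr; apply: eq_bigr => n _.
  by rewrite !exprMn -mulrDr -mulrDl sqrrN cos2Dsin2 mul1r exprVn sqr_japanese.
rewrite -E; apply: (etrans _ (mgf_gaussian_sum mg iid.2 iid.1
  (fun n => t * (cos (n%:~R * x) / jap n)) (fun n => t * (- sin (n%:~R * x) / jap n)) us)).
apply: eq_integral => w _; rewrite Re_trig_random mulr_sumr.
by congr (expR _)%:E; apply: eq_bigr => n _; rewrite mulrDr !mulrA.
Qed.

Lemma mgf_Im_trig s x t : uniq s ->
  (\int[P]_w (expR (t * complex.Im (trig (coef w) s x)))%:E = (expR (t ^+ 2 * var s
    / 4))%:E)%E.
Proof.
move=> us.
have E : \sum_(n <- s) ((t * (sin (n%:~R * x) / jap n)) ^+ 2 +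
    (t * (cos (n%:~R * x) / jap n)) ^+ 2) = t ^+ 2 * var s.
  rewrite /var mulr_sumr; apply: eq_bigr => n _.
  by rewrite !exprMn -mulrDr -mulrDl addrC cos2Dsin2 mul1r exprVn sqr_japanese.
rewrite -E; apply: (etrans _ (mgf_gaussian_sum mg iid.2 iid.1
  (fun n => t * (sin (n%:~R * x) / jap n)) (fun n => t * (cos (n%:~R * x) / jap n)) us)).
apply: eq_integral => w _; rewrite Im_trig_random mulr_sumr.
by congr (expR _)%:E; apply: eq_bigr => n _; rewrite mulrDr !mulrA.
Qed.

(** An even power is dominated by exp (t U) + exp (- t U), whose two expectations agree. The
    parameter [t] stays free, to be matched later with the variance. *)
Lemma moment_of_mgf (U : T -> R) (v t : R) j : 0 < t -> measurable_fun setT U ->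
  (forall t, \int[P]_w (expR (t * U w))%:E = (expR (t ^+ 2 * v / 4))%:E)%E ->
  (\int[P]_w (U w ^+ j.*2)%:E <=
    ((j.*2)`!%:R / t ^+ j.*2 * (2 * expR (t ^+ 2 * v / 4)))%:E)%E.
Proof.
move=> t0 mU mgfU.
have me (a : R) : measurable_fun setT (fun w => (expR (a * U w))%:E).
  by apply/measurable_EFinP; apply: measurableT_comp => //; exact: measurable_funM.
have tj0 : 0 < t ^+ j.*2 by rewrite exprn_gt0.
pose C := (j.*2)`!%:R / t ^+ j.*2.
have C0 : 0 <= C by rewrite divr_ge0// ltW.
apply: (@le_trans _ _ (\int[P]_w (C%:E * ((expR (t * U w))%:E + (expR (- t * U
  w))%:E)))%E).
  apply: ge0_le_integral => //.
  - by move=> w _; rewrite lee_fin exprn_even_ge0// odd_double.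
  - exact/measurable_EFinP/measurable_funX.
  - by apply: measurable_funeM; exact: emeasurable_funD.
  - move=> w _; rewrite -EFinD -EFinM lee_fin /C mulNr mulrAC ler_pdivlMr//.
    by rewrite mulrC -exprMn even_pow_le_cosh.
rewrite ge0_integralZl_EFin//; last 2 first.
- by move=> w _; rewrite -EFinD lee_fin addr_ge0 ?expR_ge0.
- exact: emeasurable_funD.
rewrite ge0_integralD//; try by move=> w _; rewrite lee_fin expR_ge0.
by rewrite !mgfU sqrrN -EFinD -EFinM lee_fin mulr2n mulrDl mul1r.
Qed.

End RandomTrig.

(** * Pointwise moments of the high part and Jensen's inequality *)

Section HighMoments.
Context {R : realType} d (T : measurableType d) (P : probability T R).
Variable g : int -> T -> R[i].
Hypothesis iid : iid_complex_gaussian P g.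
Local Notation muT := (@torus_measure R).
Local Notation normc := (@Normc.normc R).
Local Notation coef := (random_coef g).

Lemma normc_expr4_le (z : R[i]) k : normc z ^+ k.*2.*2 <=
  4 ^+ k * (complex.Re z ^+ k.*2.*2 + complex.Im z ^+ k.*2.*2).
Proof.
rewrite -[in normc z ^+ _]mul2n exprM normc_sqr.
apply: le_trans (exprD_le_2X _ _ _) _; rewrite ?sqr_ge0//.
rewrite (_ : 4 = 2 ^+ 2 :> R); last by ring.
by rewrite -!exprM !mul2n.
Qed.

(* From [U^(4k) <= (4k)! t^(-4k) (exp (t U) + exp (- t U))] at [t = N], for the real
   and imaginary parts [U] of the high part; the factor [4^k] recombines them. *)
Definition high_moment (N k : nat) : R :=
  4 ^+ k * ((k.*2.*2)`!%:R / N%:R ^+ k.*2.*2 * (4 * expR (N%:R / 2))).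

Lemma measurable_trig_random_slice s x :
  measurable_complex setT (fun w => trig (coef w) s x).
Proof.
have [mr mi] := measurable_trig_random iid s.
by split; [exact: (measurable_fun_pair1 x mr)|exact: (measurable_fun_pair1 x mi)].
Qed.

Lemma moment_trig_high N M x k : (0 < N)%N ->
  (\int[P]_w (normc (trig (coef w) (high N M) x) ^+ k.*2.*2)%:E <= (high_moment N
    k)%:E)%E.
Proof.
move=> N0; have us := uniq_high N M.
have [mr mi] := measurable_trig_random_slice (high N M) x.
have NR0 : 0 < N%:R :> R by rewrite ltr0n.
(* At [t = N] and variance parameter at most 2 / N, the exponent t^2 v / 4 is at most N / 2, linear
   in [N]. *)
have hv : N%:R ^+ 2 * (\sum_(n <- high N M) (1 + n%:~R ^+ 2)^-1) / 4 <= N%:R / 2 :> R.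
  apply: (@le_trans _ _ (N%:R ^+ 2 * (2 / N%:R) / 4)).
    by rewrite ler_pM2r// ler_pM2l ?exprn_gt0// sum_high_le.
  by rewrite le_eqVlt; apply/orP; left; apply/eqP; field; rewrite gt_eqF.
have hb (U : T -> R) : measurable_fun setT U ->
   (forall t, \int[P]_w (expR (t * U w))%:E = (expR (t ^+ 2 * (\sum_(n <- high N M)
     (1 + n%:~R ^+ 2)^-1) / 4))%:E)%E ->
   (\int[P]_w (U w ^+ k.*2.*2)%:E <= ((k.*2.*2)`!%:R / N%:R ^+ k.*2.*2 * (2 * expR
     (N%:R / 2)))%:E)%E.
  move=> mU mgfU; apply: le_trans (moment_of_mgf _ NR0 mU mgfU) _.
  rewrite lee_fin ler_wpM2l ?divr_ge0 ?exprn_ge0//.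
  by rewrite ler_pM2l// ler_expR.
have hr := hb _ mr (fun t => mgf_Re_trig iid x t us).
have hi := hb _ mi (fun t => mgf_Im_trig iid x t us).
have e0 (y : R) : 0 <= y ^+ k.*2.*2 by rewrite exprn_even_ge0// odd_double.
apply: (@le_trans _ _ (\int[P]_w ((4 ^+ k)%:E *
   ((complex.Re (trig (coef w) (high N M) x) ^+ k.*2.*2)%:E
    + (complex.Im (trig (coef w) (high N M) x) ^+ k.*2.*2)%:E)))%E).
  apply: ge0_le_integral => //.
  - by move=> w _; rewrite lee_fin e0.
  - by apply: measurable_normcX; split.
  - apply: measurable_funeM; apply: emeasurable_funD;
    exact/measurable_EFinP/measurable_funX.
  - by move=> w _; rewrite -EFinD -EFinM lee_fin normc_expr4_le.
rewrite ge0_integralZl_EFin ?exprn_ge0//; last 2 first.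
- by move=> w _; rewrite -EFinD lee_fin addr_ge0.
- apply: emeasurable_funD; exact/measurable_EFinP/measurable_funX.
rewrite ge0_integralD//; last 4 first.
- by move=> w _; rewrite lee_fin.
- exact/measurable_EFinP/measurable_funX.
- by move=> w _; rewrite lee_fin.
- exact/measurable_EFinP/measurable_funX.
rewrite /high_moment EFinM lee_pmul2l// ?lte_fin ?exprn_gt0//.
apply: le_trans (leeD hr hi) _; rewrite -EFinD lee_fin -mulrDr -mulrDl.
by rewrite -natrD.
Qed.

(** Jensen for a measure of total mass 2 pi: integrate the tangent inequality of the power at the
    mean [b]. Writing (2 pi)^(k - 1) as a quotient includes [k = 0]. *)
Lemma jensen_torus (F : R -> R) (a : R) k : measurable_fun setT F -> (forall x, 0
    <= F x) ->
  (\int[muT]_x (F x)%:E = a%:E)%E ->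
  ((a ^+ k)%:E <= ((2 * pi) ^+ k / (2 * pi))%:E * \int[muT]_x (F x ^+ k)%:E)%E.
Proof.
move=> mF F0 Fa.
have p0 : 0 < 2 * pi :> R by rewrite mulr_gt0 ?pi_gt0.
have a0 : 0 <= a by rewrite -lee_fin -Fa; apply: integral_ge0 => x _; rewrite lee_fin.
case: k => [|k].
  rewrite !expr0 (_ : (fun x => (F x ^+ 0)%:E) = cst 1%:E); last first.
    by apply/funext => x; rewrite expr0.
  by rewrite integral_cst// (torus_measureT : muT setT = _) mul1e -EFinM mul1r
    mulVf// gt_eqF.
pose b := a / (2 * pi).
have b0 : 0 <= b by rewrite divr_ge0// ltW.
have mFk : measurable_fun setT (fun x => (F x ^+ k.+1)%:E).
  exact/measurable_EFinP/measurable_funX.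
have I0 : (0 <= \int[muT]_x (F x ^+ k.+1)%:E)%E.
  by apply: integral_ge0 => x _; rewrite lee_fin exprn_ge0.
have : (\int[muT]_x ((k.+1%:R * b ^+ k)%:E * (F x)%:E) <=
  \int[muT]_x ((F x ^+ k.+1)%:E + cst (k%:R * b ^+ k.+1)%:E x))%E.
  apply: ge0_le_integral => //.
  - by move=> x _; rewrite -EFinM lee_fin !mulr_ge0 ?exprn_ge0.
  - by apply: measurable_funeM; exact/measurable_EFinP.
  - exact: emeasurable_funD.
  - by move=> x _; rewrite -EFinM -EFinD lee_fin power_tangent.
rewrite ge0_integralZl_EFin//; last 3 first.
- by move=> x _; rewrite lee_fin.
- exact/measurable_EFinP.
- by rewrite mulr_ge0 ?exprn_ge0.
rewrite ge0_integralD//; last 2 first.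
- by move=> x _; rewrite lee_fin exprn_ge0.
- by move=> x _; rewrite lee_fin mulr_ge0 ?exprn_ge0.
rewrite integral_cst// (torus_measureT : muT setT = _) Fa -!EFinM.
have -> : a = b * (2 * pi) by rewrite /b divfK// gt_eqF.
(* A finite integral allows subtracting the constant of the tangent line from both sides; an
   infinite one makes the bound trivial. *)
case: (\int[muT]_x (F x ^+ k.+1)%:E)%E I0 => [I I0|_ _|//].
  rewrite -EFinD !lee_fin => h.
  rewrite -ler_pdivrMl ?divr_gt0 ?exprn_gt0//.
  rewrite [(b * _) ^+ _]exprMn invfM invrK [b ^+ _ * _]mulrC mulrACA mulVf
    ?expf_neq0 ?gt_eqF// mul1r [2 * pi * _]mulrC.
  have h2 : k.+1%:R * b ^+ k * (b * (2 * pi)) = b ^+ k.+1 * (2 * pi) + k%:R * b ^+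
    k.+1 * (2 * pi).
    rewrite -natr1 exprS; ring.
  by rewrite h2 in h; move: h; rewrite lerD2r.
by rewrite gt0_muley ?leey// lte_fin divr_gt0// exprn_gt0.
Qed.

End HighMoments.

(** * The uniform exponential bound *)

Section HighLow.
Context {R : realType}.
Local Notation muT := (@torus_measure R).
Local Notation normc := (@Normc.normc R).
Implicit Types (c : int -> R[i]).

Definition quartic c s : R := fine (\int[muT]_x (normc (trig c s x) ^+ 4)%:E)%E.

Lemma integral_quartic_ge0 c s : (0 <= \int[muT]_x (normc (trig c s x) ^+ 4)%:E)%E.
Proof. by apply: integral_ge0 => x _; rewrite lee_fin exprn_ge0 ?normc_ge0. Qed.

Lemma quartic_ge0 c s : 0 <= quartic c s.
Proof. exact/fine_ge0/integral_quartic_ge0. Qed.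

(** One squared factor is bounded by its supremum, the other integrated by Parseval. *)
Lemma integral_quartic_le c s : uniq s ->
  (\int[muT]_x (normc (trig c s x) ^+ 4)%:E <=
   ((size s)%:R * energy c s * (2 * pi * energy c s))%:E)%E.
Proof.
move=> us.
have C0 : 0 <= (size s)%:R * energy c s by rewrite mulr_ge0 ?energy_ge0.
rewrite EFinM -trig_parseval//.
rewrite -ge0_integralZl_EFin//; last 2 first.
- by move=> x _; rewrite lee_fin sqr_ge0.
- exact/measurable_normcX/measurable_trig.
apply: ge0_le_integral => //.
- by move=> x _; rewrite lee_fin exprn_ge0 ?normc_ge0.
- exact/measurable_normcX/measurable_trig.
- by apply: measurable_funeM; exact/measurable_normcX/measurable_trig.
- move=> x _; rewrite -EFinM lee_fin -[X in _ ^+ X]/(2 + 2)%N exprD.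
  by rewrite ler_wpM2r ?sqr_ge0 ?normc_trig_sqr_le.
Qed.

Lemma quarticE c s : uniq s ->
  (\int[muT]_x (normc (trig c s x) ^+ 4)%:E = (quartic c s)%:E)%E.
Proof.
move=> us; rewrite fineK// ge0_fin_numE ?integral_quartic_ge0//.
by rewrite (le_lt_trans (integral_quartic_le _ us)) ?ltry.
Qed.

Lemma quartic_le c s : uniq s ->
  quartic c s <= (size s)%:R * energy c s * (2 * pi * energy c s).
Proof. by move=> us; rewrite -lee_fin -quarticE// integral_quartic_le. Qed.

Lemma normcD4_le (z w : R[i]) : normc (z + w) ^+ 4 <= 8 * normc z ^+ 4 + 8 * normc
    w ^+ 4.
Proof.
have h := normc_sqrD_le z w.
rewrite -[4%N]/(2 * 2)%N !exprM.
have := sqr_ge0 (normc z ^+ 2 - normc w ^+ 2).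
move: (sqr_ge0 (normc (z + w))) (sqr_ge0 (normc z)) (sqr_ge0 (normc w)) h.
move: (normc (z + w) ^+ 2) (normc z ^+ 2) (normc w ^+ 2) => a b c a0 b0 c0 h h2.
have : a ^+ 2 <= (2 * (b + c)) ^+ 2 by rewrite lerXn2r// nnegrE ?mulr_ge0 ?addr_ge0.
nra.
Qed.

(** Deterministic in the coefficients and free of [K] and [M] in its first term. The truncation is
    dropped on the right, and the 8 comes from |z + w|^4 <= 8 |z|^4 + 8 |w|^4. *)
Lemma trunc_integral_split K m c N M : 0 <= K -> energy c (modes M) <= m ->
  fine (trunc_integral K M c) <=
  8 * (N.*2.+1%:R * m * (2 * pi * m)) + 8 * quartic c (high N M).
Proof.
move=> K0 em.
have p0 := pi_ge0 R.
have el : energy c (low N M) <= m.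
  by apply: le_trans em; rewrite (energy_modes_split c N) lerDl energy_ge0.
apply: (@le_trans _ _ (8 * quartic c (low N M) + 8 * quartic c (high N M))); last first.
  rewrite lerD2r ler_pM2l// (le_trans (quartic_le _ (uniq_low _ _)))//.
  have := energy_ge0 c (low N M) => e0.
  apply: ler_pM; rewrite ?mulr_ge0//.
    by apply: ler_pM => //; rewrite ler_nat size_low.
  by rewrite ler_wpM2l// mulr_ge0.
rewrite -lee_fin fineK ?trunc_integral_fin// EFinD !EFinM -!quarticE ?uniq_low
  ?uniq_high//.
have mt s : measurable_fun setT (fun x => (normc (trig c s x) ^+ 4)%:E).
  exact/measurable_normcX/measurable_trig.
have t0 s x : (0 <= (normc (trig c s x) ^+ 4)%:E)%E by rewrite lee_fin exprn_ge0
  ?normc_ge0.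
have hZ s : (8%:E * \int[muT]_x (normc (trig c s x) ^+ 4)%:E =
    \int[muT]_x (8%:E * (normc (trig c s x) ^+ 4)%:E))%E.
  by rewrite ge0_integralZl_EFin//; exact: mt.
rewrite !hZ -ge0_integralD//; try (by move=> x _; rewrite mule_ge0);
  try (by apply: measurable_funeM; exact: mt).
apply: ge0_le_integral => //.
- by move=> x _; rewrite lee_fin trunc4_ge0.
- exact/measurable_trunc4/measurable_trig.
- by apply: emeasurable_funD; apply: measurable_funeM; exact: mt.
- move=> x _; rewrite -!EFinM -EFinD lee_fin (le_trans (trunc4_le_normc _ K0))//.
  by rewrite (trig_modes_split c N) normcD4_le.
Qed.

End HighLow.

Section HighQuartic.
Context {R : realType} d (T : measurableType d) (P : probability T R).
Variable g : int -> T -> R[i].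
Hypothesis iid : iid_complex_gaussian P g.
Local Notation muT := (@torus_measure R).
Local Notation normc := (@Normc.normc R).
Local Notation coef := (random_coef g).

Lemma measurable_quartic s : uniq s -> measurable_fun setT (fun w => quartic (coef
    w) s).
Proof.
move=> us; apply/measurable_EFinP.
rewrite (_ : _ \o _ = fun w => (\int[muT]_x (normc (trig (coef w) s x) ^+ 4)%:E)%E);
  last first.
  by apply/funext => w /=; rewrite quarticE.
apply: (@measurable_torus_integral R _ T (fun z => (normc (trig (coef z.1) s z.2)
  ^+ 4)%:E)).
  exact/measurable_normcX/(measurable_trig_random iid).
by move=> z; rewrite lee_fin exprn_ge0 ?normc_ge0.
Qed.

Lemma measurable_trunc_integral K M : measurable_fun setT (fun w => trunc_integral
    K M (coef w)).
Proof.
apply: (@measurable_torus_integral R _ T (fun z => (trunc4 K (trig (coef z.1)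
  (modes M) z.2))%:E)).
  exact/measurable_trunc4/(measurable_trig_random iid).
by move=> z; rewrite lee_fin trunc4_ge0.
Qed.

Lemma measurable_energy s : measurable_fun setT (fun w => energy (coef w) s).
Proof.
under eq_fun do rewrite energy_random_coef.
apply: measurable_sum => n; apply: measurable_funM => //.
by apply/measurable_funX/measurable_normc; case: (iid.1 n).
Qed.

(** Jensen moves the power inside the integral over the torus and Tonelli exchanges it with the
    expectation; the pointwise moment is uniform in [x], so the last integration restores the factor
    2 pi that Jensen divides by. *)
Lemma moment_quartic_high N M k : (0 < N)%N ->
  (\int[P]_w (quartic (coef w) (high N M) ^+ k)%:E <= ((2 * pi) ^+ k * high_moment
    N k)%:E)%E.
Proof.
move=> N0.
have p0 : 0 < 2 * pi :> R by rewrite mulr_gt0 ?pi_gt0.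
have us := uniq_high N M.
pose F (z : T * R) := (normc (trig (coef z.1) (high N M) z.2) ^+ k.*2.*2)%:E.
have mF : measurable_fun setT F by exact/measurable_normcX/(measurable_trig_random iid).
have F0 z : (0 <= F z)%E by rewrite lee_fin exprn_ge0 ?normc_ge0.
have cE : 0 <= (2 * pi) ^+ k / (2 * pi) :> R by rewrite divr_ge0 ?exprn_ge0// ltW.
apply: (@le_trans _ _ (\int[P]_w (((2 * pi) ^+ k / (2 * pi))%:E * \int[muT]_x F (w,
  x)))%E).
  apply: ge0_le_integral => //.
  - by move=> w _; rewrite lee_fin exprn_ge0 ?quartic_ge0.
  - exact/measurable_EFinP/measurable_funX/measurable_quartic.
  - by apply: measurable_funeM; exact: measurable_torus_integral.
  - move=> w _.
    have := @jensen_torus R (fun x => normc (trig (coef w) (high N M) x) ^+ 4) _ k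
      _ _ (quarticE _ us).
    under eq_integral do rewrite -exprM -[(4 * k)%N]/(2 * 2 * k)%N -mulnA !mul2n.
    apply; last by move=> x; rewrite exprn_ge0 ?normc_ge0.
    exact/measurable_funX/measurable_normc/measurable_trig.
rewrite ge0_integralZl_EFin//; last 2 first.
- by move=> w _; exact: integral_ge0.
- exact: measurable_torus_integral.
rewrite torus_tonelli//.
apply: (@le_trans _ _ (((2 * pi) ^+ k / (2 * pi))%:E * \int[muT]_x cst (high_moment
  N k)%:E x)%E).
  rewrite lee_wpmul2l//.
  apply: ge0_le_integral => //.
  - by move=> x _; exact: integral_ge0.
  - exact: (@measurable_fun_fubini_tonelli_G _ _ T (measurableTypeR R) R P F).
  - by move=> x _; exact: moment_trig_high.
rewrite integral_cst// (torus_measureT : muT setT = _) -!EFinM lee_fin.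
by rewrite [high_moment _ _ * _]mulrC mulrA divfK// gt_eqF.
Qed.

End HighQuartic.

(** * Termwise bounds for the exponential series *)

Section Series.
Context {R : realType}.

Lemma expR_eseries (x : R) : ((expR x)%:E = \sum_(k <oo) (x ^+ k / k`!%:R)%:E)%E.
Proof.
apply/esym/cvg_lim => //.
rewrite (_ : (fun n => _) = EFin \o series (exp_coeff x)).
  by apply: cvg_EFin; [exact: nearW|exact: is_cvg_series_exp_coeff].
by apply/funext => n; rewrite /= sumEFin.
Qed.

Lemma geometric_eseries : (\sum_(k <oo) ((2^-1 : R) ^+ k)%:E = 2%:E)%E.
Proof.
apply/cvg_lim => //.
rewrite (_ : (fun n => _) = EFin \o series (geometric (1 : R) 2^-1)).
  apply: cvg_EFin; first exact: nearW.
  have {2}-> : 2 = 1 * (1 - 2^-1)^-1 :> R by field.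
  by apply: cvg_geometric_series; rewrite ger0_norm// invf_lt1// ltr1n.
by apply/funext => n; rewrite /= sumEFin; congr EFin; apply: eq_bigr => i _;
  rewrite /geometric /= mul1r.
Qed.

(** The number of modes is at most 2 k / L + 3. The part proportional to k meets k^k / k! <= e^k and
    becomes geometric with ratio 4 B e / L, which the hypothesis on [L] brings below 1/2; the
    constant 3 leaves a term of an exponential series. *)
Lemma low_term_le (B : R) (L k : nat) : 0 <= B -> (0 < L)%N -> 8 * B * expR 1 <= L%:R ->
  (B * ((k %/ L).+1.*2.+1)%:R) ^+ k / k`!%:R <= 2^-1 ^+ k + (6 * B) ^+ k / k`!%:R.
Proof.
move=> B0 L0 BL.
have LR : 0 < L%:R :> R by rewrite ltr0n.
have k0 : 0 < k`!%:R :> R by rewrite ltr0n fact_gt0.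
have h1 : ((k %/ L).+1.*2.+1)%:R <= 2 * k%:R / L%:R + 3 :> R.
  have : ((k %/ L)%:R * L%:R <= k%:R :> R) by rewrite -natrM ler_nat leq_divM.
  rewrite -ler_pdivlMr// => h.
  rewrite -addn1 -addnn !natrD -!natr1. lra.
apply: (@le_trans _ _ ((2 * B * k%:R / L%:R + 3 * B) ^+ k / k`!%:R)).
  have h2 := ler_wpM2l B0 h1.
  have h3 : B * (k %/ L).+1.*2.+1%:R <= 2 * B * k%:R / L%:R + 3 * B.
    by apply: le_trans h2 _; rewrite le_eqVlt; apply/orP; left; apply/eqP; ring.
  have h4 : 0 <= B * (k %/ L).+1.*2.+1%:R by rewrite mulr_ge0.
  by rewrite ler_pM2r ?invr_gt0// lerXn2r ?nnegrE// (le_trans h4).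
apply: (@le_trans _ _ (2 ^+ k * ((2 * B * k%:R / L%:R) ^+ k + (3 * B) ^+ k) / k`!%:R)).
  by rewrite ler_pM2r ?invr_gt0// exprD_le_2X ?mulr_ge0 ?invr_ge0.
rewrite mulrDr mulrDl -!exprMn; apply: lerD; last first.
  by rewrite (_ : 2 * (3 * B) = 6 * B)//; ring.
have -> : (2 * (2 * B * k%:R / L%:R)) ^+ k / k`!%:R = (4 * B / L%:R) ^+ k * (k%:R
  ^+ k / k`!%:R).
  rewrite [RHS]mulrA -exprMn; congr (_ ^+ k / _); ring.
apply: (@le_trans _ _ ((4 * B / L%:R) ^+ k * expR 1 ^+ k)).
  rewrite ler_wpM2l ?exprn_ge0 ?mulr_ge0 ?invr_ge0//.
  by rewrite -expRM_natr mul1r expR_ge_pow.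
rewrite -exprMn lerXn2r ?nnegrE ?mulr_ge0 ?invr_ge0 ?expR_ge0//.
rewrite mulrAC ler_pdivrMr//. lra.
Qed.

(** With N the successor of k / L one has k <= L N, so (4 k)! <= (4 k)^(4 k) gives at most (4 L)^(4
    k) after division by N^(4 k). Also N <= k + 1, so exp (N / 2) is at most geometric, and k! is
    left to ensure convergence. *)
Lemma high_term_le (C : R) (L k : nat) : 0 <= C -> (0 < L)%N ->
  C ^+ k / k`!%:R * high_moment (k %/ L).+1 k <=
  4 * expR 1 * ((4 * C * (4 * L%:R) ^+ 4 * expR 1) ^+ k / k`!%:R).
Proof.
move=> C0 L0; rewrite /high_moment; set N := (k %/ L).+1.
have k0 : 0 < k`!%:R :> R by rewrite ltr0n fact_gt0.
have LR : 0 < L%:R :> R by rewrite ltr0n.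
have NR : 0 < N%:R :> R by rewrite ltr0n.
have kN : (k <= L * N)%N by rewrite mulnC ltnW// ltn_ceil.
have f1 : (k.*2.*2)`!%:R / N%:R ^+ k.*2.*2 <= (4 * L%:R) ^+ 4 ^+ k :> R.
  rewrite ler_pdivrMr ?exprn_gt0// -exprM.
  have -> : (4 * k = k.*2.*2)%N by lia.
  rewrite -exprMn -!natrM -natrX ler_nat (leq_trans (fact_leq_expn _))//.
  have [->//|kp] := posnP k.
  by rewrite leq_exp2r ?double_gt0//; lia.
have f2 : expR (N%:R / 2) <= expR 1 * expR 1 ^+ k :> R.
  rewrite -exprS -expRM_natr mul1r ler_expR.
  have : (N%:R <= k.+1%:R :> R) by rewrite ler_nat ltnS leq_div.
  have := ler0n R k; rewrite -natr1. lra.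
have p1 := expR_ge0 (1 : R).
rewrite !exprMn.
apply: (@le_trans _ _ (C ^+ k / k`!%:R * (4 ^+ k * ((4 * L%:R) ^+ 4 ^+ k * (4 *
  (expR 1 * expR 1 ^+ k)))))); last first.
  rewrite le_eqVlt; apply/orP; left; apply/eqP; rewrite !exprMn; ring.
rewrite ler_wpM2l ?mulr_ge0 ?exprn_ge0 ?invr_ge0//.
rewrite ler_wpM2l ?exprn_ge0//.
by apply: ler_pM; rewrite ?divr_ge0 ?exprn_ge0 ?mulr_ge0 ?expR_ge0 ?ler_wpM2l.
Qed.

End Series.

Section ExponentialBound.
Context {R : realType} d (T : measurableType d) (P : probability T R).
Variable g : int -> T -> R[i].
Hypothesis iid : iid_complex_gaussian P g.
Local Notation coef := (random_coef g).

Lemma measurable_energy_le s (m : R) : measurable [set w | energy (coef w) s <= m].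
Proof.
rewrite -[X in measurable X]setTI.
have -> : [set w | energy (coef w) s <= m] = (fun w => energy (coef w) s) @^-1`
  `]-oo, m].
  by apply/seteqP; split => w /=; rewrite in_itv.
by apply: (measurable_energy iid) => //; exact: measurable_itv.
Qed.

Lemma uniform_exp_bound (q m : R) : 0 <= q -> exists C : R, forall K M, 0 <= K ->
  (\int[P]_(w in [set w | (energy (coef w) (modes M) <= m)%R])
     (expR (q * fine (trunc_integral K M (coef w))))%:E <= C%:E)%E.
Proof.
move=> q0; have p0 := pi_ge0 R.
(* 32 pi is the product of 2 from [exprD_le_2X], 8 from [trunc_integral_split] and 2 pi from
   Parseval. In [c1] the same 2 pi comes from Jensen instead. *)
pose B := 32 * q * pi * m ^+ 2.
have B0 : 0 <= B by apply: mulr_ge0; rewrite ?sqr_ge0// !mulr_ge0.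
have [L L0 BL] : exists2 L : nat, (0 < L)%N & 8 * B * expR 1 <= L%:R.
  exists (Num.truncn (8 * B * expR 1)).+1 => //.
  exact/ltW/truncnS_gt.
pose c1 := 32 * pi * q.
have c10 : 0 <= c1 by rewrite !mulr_ge0.
pose c2 := 4 * c1 * (4 * L%:R) ^+ 4 * expR 1.
have c20 : 0 <= c2 by rewrite !mulr_ge0 ?exprn_ge0 ?expR_ge0 ?mulr_ge0.
(* The splitting frequency of the k-th term; the successor keeps it positive when [k < L]. *)
pose N k := (k %/ L).+1.
(* The three summands are the sums over k of the geometric and the exponential part of [low_term_le]
   and of the bound of [high_term_le]. *)
exists (2 + expR (6 * B) + 4 * expR 1 * expR c2) => K M K0.
set A := [set w | _].
have mA : measurable A by exact: measurable_energy_le.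
pose a k := (B * ((N k).*2.+1)%:R) ^+ k / k`!%:R.
pose b k := (16 * q) ^+ k / k`!%:R.
have a0 k : 0 <= a k by apply: divr_ge0 => //; apply: exprn_ge0; exact: mulr_ge0.
have b0 k : 0 <= b k by apply: divr_ge0 => //; apply: exprn_ge0; exact: mulr_ge0.
pose W k w := quartic (coef w) (high (N k) M) ^+ k.
have W0 k w : 0 <= W k w by apply: exprn_ge0; exact: quartic_ge0.
have mW k : measurable_fun setT (fun w => (W k w)%:E).
  by apply/measurable_EFinP/measurable_funX/(measurable_quartic iid); rewrite uniq_high.
pose f k w := ((a k)%:E + (b k)%:E * (W k w)%:E)%E.
have f0 k w : (0 <= f k w)%E by rewrite adde_ge0 ?mule_ge0 ?lee_fin.
have mf k : measurable_fun setT (f k).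
  by apply: emeasurable_funD => //; exact: measurable_funeM.
have mS : measurable_fun setT (fun w => \sum_(k <oo) f k w)%E.
  by apply: ge0_emeasurable_sum.
have mJ : measurable_fun setT (fun w => (expR (q * fine (trunc_integral K M (coef
  w))))%:E).
  apply/measurable_EFinP; apply: measurableT_comp => //; apply: measurable_funM => //.
  apply: (measurableT_comp (@fine_measurable R setT measurableT)).
  exact: (measurable_trunc_integral iid).
apply: (@le_trans _ _ (\int[P]_w \sum_(k <oo) f k w)%E).
  (* The event [A] is used only for the pointwise comparison, to bound the low part. It is then
     enlarged to the whole space, where the moments of the high part are known. *)
  apply: (@le_trans _ _ (\int[P]_(w in A) \sum_(k <oo) f k w)%E); last first.
    by apply: ge0_subset_integral => // w _; apply: nneseries_ge0.
  apply: ge0_le_integral => //.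
  - exact: measurable_funTS.
  - exact: measurable_funTS.
  - move=> w Aw; rewrite expR_eseries; apply: lee_nneseries => [k _ _|k _].
      by rewrite lee_fin divr_ge0 ?exprn_ge0// mulr_ge0// fine_ge0 ?trunc_integral_ge0.
    rewrite /f -EFinM -EFinD lee_fin /a /b [_ * W k w]mulrAC -mulrDl ler_pM2r
      ?invr_gt0 ?ltr0n ?fact_gt0//.
    have h := trunc_integral_split (N k) K0 Aw.
    have m0 : 0 <= m := le_trans (energy_ge0 _ _) Aw.
    have J0 : 0 <= fine (trunc_integral K M (coef w)) by rewrite fine_ge0
      ?trunc_integral_ge0.
    apply: (@le_trans _ _ ((q * (8 * ((N k).*2.+1%:R * m * (2 * pi * m))) +
        q * (8 * quartic (coef w) (high (N k) M))) ^+ k)).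
      rewrite -mulrDr lerXn2r ?nnegrE ?mulr_ge0//; last by rewrite ler_wpM2l.
      exact: le_trans h.
    have Q0 := quartic_ge0 (coef w) (high (N k) M).
    apply: le_trans (exprD_le_2X _ _ _) _; rewrite ?mulr_ge0//.
    rewrite /W mulrDr -!exprMn le_eqVlt; apply/orP; left; apply/eqP.
    by congr (_ ^+ _ + _ ^+ _); rewrite /B; ring.
rewrite integral_nneseries//.
apply: (@le_trans _ _ (\sum_(k <oo) (((2^-1 ^+ k)%:E + ((6 * B) ^+ k / k`!%:R)%:E) +
    (4 * expR 1)%:E * (c2 ^+ k / k`!%:R)%:E))%E).
  apply: lee_nneseries => [k _ _|k _]; first exact: integral_ge0.
  rewrite /f ge0_integralD//; last 3 first.
  - by move=> w _; rewrite lee_fin.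
  - by move=> w _; rewrite mule_ge0 ?lee_fin.
  - exact: measurable_funeM.
  rewrite integral_cst// [X in (_ * X)%E](_ : _ = 1%E); last exact: probability_setT.
  rewrite mule1 ge0_integralZl_EFin//; last first.
    by move=> w _; rewrite lee_fin.
  apply: leeD; first by rewrite -EFinD lee_fin low_term_le.
  apply: (@le_trans _ _ ((b k)%:E * ((2 * pi) ^+ k * high_moment (N k) k)%:E)%E).
    by rewrite lee_wpmul2l ?lee_fin//; exact: (moment_quartic_high iid).
  rewrite -!EFinM lee_fin; apply: le_trans (high_term_le k c10 L0).
  rewrite le_eqVlt; apply/orP; left; apply/eqP.
  rewrite /b mulrA; congr (_ * _); rewrite mulrAC -exprMn; congr (_ ^+ _ / _).
  by rewrite /c1; ring.
have e0 (x : R) k : 0 <= x -> (0 <= (x ^+ k / k`!%:R)%:E)%E.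
  by move=> x0; rewrite lee_fin divr_ge0// exprn_ge0.
have B60 : 0 <= 6 * B by rewrite mulr_ge0.
have e40 : (0 <= (4 * expR 1 : R)%:E)%E by rewrite lee_fin mulr_ge0// expR_ge0.
have h0 k : (0 <= ((2^-1 : R) ^+ k)%:E)%E by rewrite lee_fin exprn_ge0.
rewrite nneseriesD; last 2 first.
- by move=> k _ _; rewrite adde_ge0// e0.
- by move=> k _ _; rewrite mule_ge0// e0.
rewrite nneseriesD; last 2 first.
- by move=> k _ _; exact: h0.
- by move=> k _ _; exact: e0.
rewrite nneseriesZl; last by move=> k _; exact: e0.
by rewrite geometric_eseries -!expR_eseries -EFinM -!EFinD.
Qed.

End ExponentialBound.

(** * Passage to the limit *)

Section Cutoff.
Context {R : realType}.

Lemma measurable_expeR : measurable_fun setT (@expeR R).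
Proof.
(* [er_map] sends -oo to itself while [expeR] sends it to 0, hence the case distinction. *)
rewrite (_ : @expeR R = fun x => if x == -oo%E then 0%E else er_map expR x); last first.
  by apply/funext => -[].
apply: measurable_fun_if => //.
- apply: (measurable_fun_bool true).
  rewrite setTI (_ : _ @^-1` _ = [set -oo%E]); last first.
    by apply/seteqP; split => x /=; [move/eqP|move=> ->; rewrite eqxx].
  exact: emeasurable_set1.
- apply: measurable_funTS; exact: (measurable_er_map (measurableTypeR R)).
Qed.

Variable chi : R -> R.
Hypothesis chiP : is_cutoff chi.

Lemma continuous_cutoff : continuous chi.
Proof.
case: chiP => sm _ _ _ x.
by apply: differentiable_continuous; apply/derivable1_diffP; exact: (sm 0%N x).
Qed.

Lemma cutoff_ge0 r s : (0 <= cutoff chi r s)%E.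
Proof. by case: s => //= t; rewrite lee_fin; case: chiP => _ /(_ (t / r))/andP[]. Qed.

Lemma cutoff_le1 r s : (cutoff chi r s <= 1)%E.
Proof. by case: s => //= t; rewrite lee_fin; case: chiP => _ /(_ (t / r))/andP[]. Qed.

Lemma cutoff_eq0 r s : 0 < r -> ((2 * r)%:E < s)%E -> cutoff chi r s = 0%E.
Proof.
move=> r0; case: s => //= t; rewrite lte_fin => rt; congr EFin.
case: chiP => _ _ _ supp; apply/eqP/negPn/negP => h.
have /supp : closure [set x | chi x != 0] (t / r) by exact: subset_closure.
by rewrite /= in_itv /= => /andP[_]; rewrite ler_pdivrMr// leNgt rt.
Qed.

Lemma measurable_cutoff r : measurable_fun setT (cutoff chi r).
Proof.
rewrite (_ : cutoff chi r = fun s => if s \is a fin_num then (chi (fine s / r))%:E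
  else 0%E); last first.
  by apply/funext => -[].
apply: measurable_fun_if => //.
- apply: (measurable_fun_bool true).
  by apply: (emeasurable_fin_num (f := id)) => //; exact: measurable_id.
- apply: measurable_funTS; apply/measurable_EFinP.
  apply: (measurableT_comp (continuous_measurable_fun continuous_cutoff)).
  by apply: measurable_funM => //; exact: fine_measurable.
Qed.

End Cutoff.

(** * Identification of the limit, measurability and Fatou's lemma *)

Section Limit.
Context {R : realType} d (T : measurableType d) (P : probability T R).
Variable g : int -> T -> R[i].
Hypothesis iid : iid_complex_gaussian P g.
Local Notation coef := (random_coef g).

(** The unordered sum is a supremum over finite sets of frequencies, and every finite set lies in
    some symmetric range. *)
Lemma random_mass_cvg w : (energy (coef w) (modes N))%:E @[N --> \oo] -->
    random_mass g w.
Proof.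
pose a n : \bar R := (Normc.normc (g n w) ^+ 2 / japanese n ^+ 2)%:E.
have a0 n : (0 <= a n)%E by rewrite lee_fin divr_ge0 ?sqr_ge0.
have E N : (energy (coef w) (modes N))%:E = (\sum_(n \in [set` modes N]) a n)%E.
  by rewrite energy_random_coef -sumEFin (fsbig_seq _ _ (uniq_modes N)).
have -> : random_mass g w = ereal_sup (range (fun N => (energy (coef w) (modes N))%:E)).
  apply/eqP; rewrite eq_le; apply/andP; split.
    apply: ge_ereal_sup => _ [A [/finite_fsetP[F ->] _] <-].
    pose N := \max_(n <- F) `|n|%N.
    apply: (@le_trans _ _ (energy (coef w) (modes N))%:E); last first.
      by apply: ereal_sup_ubound; exists N.
    rewrite E; apply: lee_fsum_nneg_subset => //; last by move=> n _; exact: a0.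
      exact: finite_seq.
    move=> n; rewrite !inE /= mem_modes => nF.
    by rewrite /N (big_rem n)//= leq_maxl.
  apply: ge_ereal_sup => _ [N _ <-]; rewrite E; apply: esum_ge.
  by exists [set` modes N] => //; split=> //; exact: finite_seq.
apply: ereal_nondecreasing_cvgn => N M NM.
by rewrite lee_fin energy_modes_nd.
Qed.

Lemma random_mass_ge w N : ((energy (coef w) (modes N))%:E <= random_mass g w)%E.
Proof.
rewrite -(cvg_lim _ (@random_mass_cvg w))//; apply: lime_ge.
  by apply/cvg_ex; exists (random_mass g w); exact: random_mass_cvg.
by near=> M; rewrite lee_fin energy_modes_nd//; near: M; exact: nbhs_infty_ge.
Unshelve. all: by end_near. Qed.

Lemma measurable_random_mass : measurable_fun setT (random_mass g).
Proof.
apply: (emeasurable_fun_cvg (fun N w => (energy (coef w) (modes N))%:E)).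
  by move=> N; apply/measurable_EFinP; exact: (measurable_energy iid).
by move=> w _; exact: random_mass_cvg.
Qed.

Lemma random_mass_ge0 w : (0 <= random_mass g w)%E.
Proof. by apply: le_trans (random_mass_ge w 0); rewrite lee_fin energy_ge0. Qed.

(** Finite mass bounds all partial energies, so a sum exists and the default value of [fourier_sum]
    is not taken. *)
Lemma fourier_sumP w : (random_mass g w < +oo)%E ->
  is_fourier_sum (coef w) (fourier_sum (coef w)).
Proof.
move=> fm; apply: xgetPex.
apply: (@riesz_fischer R (coef w) (fine (random_mass g w))) => N.
rewrite -lee_fin fineK ?random_mass_ge//.
by rewrite ge0_fin_numE// random_mass_ge0.
Qed.

Let X w := (LnormT 4 (fourier_sum (coef w)) ^+ 4)%E.
(** A stand-in for [X] built from measurable quantities only: [fourier_sum] chooses a representative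
    separately for each [w], which by itself says nothing about measurability in [w]. *)
Let Y w := limn_esup (fun K : nat => limn_esup (fun N : nat => trunc_integral K%:R
    N (coef w))).
Let YK (K : nat) w := limn_esup (fun N : nat => trunc_integral K%:R N (coef w)).

Let YK_cvg K w : (random_mass g w < +oo)%E ->
  trunc_integral K%:R N (coef w) @[N --> \oo] --> YK K w /\ YK K w \is a fin_num.
Proof.
move=> /fourier_sumP fs; have := trunc_integral_cvg (ler0n _ K) fs => h.
have e : YK K w = (\int[torus_measure]_x (trunc4 K%:R (fourier_sum (coef w) x))%:E)%E.
  exact: (cvg_limn_einf_sup h).2.
rewrite e; split => //.
rewrite ge0_fin_numE; last by apply: integral_ge0 => x _; rewrite lee_fin trunc4_ge0.
by rewrite (le_lt_trans (integral_trunc4_le (ler0n _ K) fs.1)) ?ltry.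
Qed.

Let X_cvg w : (random_mass g w < +oo)%E -> YK K w @[K --> \oo] --> X w.
Proof.
move=> fm; have fs := fourier_sumP fm.
rewrite (_ : YK ^~ w = fun K : nat => (\int[torus_measure]_x (trunc4 K%:R
  (fourier_sum (coef w) x))%:E)%E).
  exact: (integral_trunc4_cvg fs.1).
apply/funext => K; exact: (cvg_limn_einf_sup (trunc_integral_cvg (ler0n _ K) fs)).2.
Qed.

Let XY w : (random_mass g w < +oo)%E -> X w = Y w.
Proof. by move=> fm; rewrite /Y (cvg_limn_einf_sup (X_cvg fm)).2. Qed.

Let mY : measurable_fun setT Y.
Proof.
apply: measurable_fun_limn_esup => K; apply: measurable_fun_limn_esup => N.
exact: (measurable_trunc_integral iid).
Qed.

Variable chi : R -> R.
Hypothesis chiP : is_cutoff chi.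
Variables (r q : R).
Hypotheses (r0 : 0 < r) (q1 : 1 <= q).

Let f w := (expeR (X w) * cutoff chi r (random_mass g w))%E.

Let mf : measurable_fun setT f.
Proof.
(* [X] and [Y] may differ where the mass is infinite, but there the cutoff is 0 and the product
   vanishes even if the exponential is infinite. *)
have -> : f = fun w => (expeR (Y w) * cutoff chi r (random_mass g w))%E.
  apply/funext => w; rewrite /f; have [fm|] := ltP (random_mass g w) +oo%E.
    by rewrite XY.
  by rewrite leye_eq => /eqP ->; rewrite /= !mule0.
apply: emeasurable_funM.
  exact: (measurableT_comp measurable_expeR mY).
exact: (measurableT_comp (measurable_cutoff chiP r) measurable_random_mass).
Qed.

Let m : R := 2 * r.
(** The event constrains the energy of the truncated series. It contains the event that the full
    mass is at most [m], and it is the one on which [uniform_exp_bound] holds. *)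
Let h (K N : nat) w : \bar R :=
  (\1_[set w | energy (coef w) (modes N) <= m] w *
   expR (q * fine (trunc_integral K%:R N (coef w))))%:E.

Let q0 : 0 < q. Proof. exact: lt_le_trans ltr01 q1. Qed.

(** If the mass exceeds [m = 2 r] the cutoff kills the left side. Otherwise every indicator equals
    1, and the inner limit in [N] followed by the outer limit in [K] gives exp (q X), including the
    case where [X] is infinite. *)
Let f_le w : (`|f w| `^ q <= limn_einf (fun K => limn_einf (fun N => h K N w)))%E.
Proof.
have h0 K N : (0 <= h K N w)%E by rewrite lee_fin mulr_ge0 ?expR_ge0.
rewrite gee0_abs; last by rewrite mule_ge0 ?expeR_ge0 ?cutoff_ge0.
have [mm|mm] := leP (random_mass g w) m%:E; last first.
  rewrite /f cutoff_eq0// mule0 poweR0r ?gt_eqF//.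
  by apply: limn_einf_ge0 => K; exact: limn_einf_ge0.
have fm : (random_mass g w < +oo)%E by rewrite (le_lt_trans mm) ?ltry.
have hE K N : h K N w = expeR (q%:E * trunc_integral K%:R N (coef w)).
  rewrite /h indicE mem_set ?mul1r; last first.
    by rewrite /= -lee_fin (le_trans (random_mass_ge w N)).
  by rewrite -[in RHS](fineK (trunc_integral_fin N (coef w) (ler0n R K))).
have YK0 K : (0 <= YK K w)%E.
  have [hc _] := YK_cvg K fm; rewrite -(cvg_lim _ hc)//; apply: lime_ge.
    by apply/cvg_ex; exists (YK K w).
  by apply: nearW => N; exact: trunc_integral_ge0.
have X0 : (0 <= X w)%E by rewrite expe_ge0 ?LnormT_ge0.
have qYf K : (q%:E * YK K w \is a fin_num)%E by rewrite fin_numM//;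
  exact: (YK_cvg K fm).2.
have e1 K : limn_einf (fun N => h K N w) = expeR (q%:E * YK K w).
  under eq_fun do rewrite hE.
  apply: (cvg_limn_einf_sup _).1; apply: expeR_cvg.
  - by move=> N; rewrite fin_numM// trunc_integral_fin.
  - by move: (qYf K); case: (q%:E * _)%E.
  - by apply: cvgeZl => //; exact: (YK_cvg K fm).1.
rewrite (_ : (fun K => _) = fun K => expeR (q%:E * YK K w)); last exact/funext/e1.
rewrite (cvg_limn_einf_sup (_ : _ --> expeR (q%:E * X w))).1; last first.
  apply: expeR_cvg => //; last by apply: cvgeZl => //; exact: X_cvg.
  by rewrite gt_eqF// (lt_le_trans ltNy0)// mule_ge0// lee_fin ltW.
have -> : expeR (q%:E * X w) = (expeR (X w) `^ q)%E.
  case: (X w) X0 => [x _|_|//].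
    by rewrite /= mulrC expRM.
  by rewrite gt0_muley ?lte_fin// -[expeR +oo]/(+oo%E : \bar R) poweRyr ?gt_eqF.
apply: gt0_ler_poweR; rewrite ?(ltW q0)//.
- by rewrite in_itv /= leey andbT mule_ge0 ?expeR_ge0 ?cutoff_ge0.
- by rewrite in_itv /= leey andbT expeR_ge0.
- by rewrite -[leRHS]mule1 lee_wpmul2l ?expeR_ge0// cutoff_le1.
Qed.

Let mh K N : measurable_fun setT (h K N).
Proof.
apply/measurable_EFinP; apply: measurable_funM.
  by apply: measurable_indic; exact: (measurable_energy_le iid).
apply: measurableT_comp => //; apply: measurable_funM => //.
apply: (measurableT_comp (@fine_measurable R setT measurableT)).
exact: (measurable_trunc_integral iid).
Qed.

Let int_f : (\int[P]_w (`|f w| `^ q) < +oo)%E.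
Proof.
have h0 K N w : (0 <= h K N w)%E by rewrite lee_fin mulr_ge0 ?expR_ge0.
have [C hC] := uniform_exp_bound iid m (ltW q0).
apply: (@le_lt_trans _ _ C%:E); last exact: ltry.
have mhK K : measurable_fun setT (fun w => limn_einf (fun N => h K N w)).
  exact: measurable_limn_einf.
apply: (@le_trans _ _ (\int[P]_w limn_einf (fun K => limn_einf (fun N => h K N w)))%E).
  apply: ge0_le_integral => //.
  - by move=> w _; exact: poweR_ge0.
  - apply: (measurableT_comp (measurable_poweR q)).
    exact: (measurableT_comp (@abse_measurable R setT)).
  - exact: measurable_limn_einf.
(* Fatou is applied once for each limit, first in [K] and then in [N]; the constant [C] depends on
   neither. *)
apply: le_trans.
  by apply: fatou => // K w _; apply: limn_einf_ge0 => N.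
apply: limn_einf_le_cst => K.
apply: le_trans.
  by apply: fatou => // N w _.
apply: limn_einf_le_cst => N.
apply: le_trans (hC K%:R N (ler0n _ K)).
by rewrite integral_indicM//; exact: (measurable_energy_le iid).
Qed.

Lemma in_Lp_exp_quartic : in_Lp P q f.
Proof.
split; first exact: mf.
by rewrite unlock; exact: (poweR_lty _ int_f).
Qed.

End Limit.

Theorem lemma4p5 (R : realType) (d : measure_display) (T : measurableType d)
    (P : probability T R) (g : int -> T -> R[i]) (chi : R -> R) (r q : R) :
  iid_complex_gaussian P g ->
  is_cutoff chi ->
  0 < r ->
  1 <= q ->
  in_Lp P q (fun w =>
    expeR (LnormT 4 (fourier_sum (random_coef g w)) ^+ 4) *
    cutoff chi r (random_mass g w))%E.
Proof. by move=> iid chiP r0 q1; exact: in_Lp_exp_quartic. Qed.
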